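(* Let $f$ be a $C^{1+\alpha}$ diffeomorphism of $M=\mathbb{R}^d/\mathbb{Z}^d$ ($\alpha>0$) and $\Lambda\subseteq M$ an invariant set. Suppose there is $n\in\{1,2,\dots\}\cup\{\infty\}$ such that for every $x\in\Lambda$, $\Gamma_{o(x)}$ has a continuous inverse on $X_n$. Then $\Lambda$ is shadowable.
   Context: Tangent spaces identified with $\mathbb{R}^d$; distances on $M$ are denoted $|x-y|$. $o(x)=(f^k(x))_{k\in\mathbb{Z}}$; for $\mathbf{x}\in M^{\mathbb{Z}}$, $(\Gamma_{\mathbf{x}}\eta)_k=\eta_k-Df(x_{k-1})\eta_{k-1}$. $\|\eta\|_n=\sup_k e^{-|k|/n}|\eta_k|$, $X_n=\{\|\eta\|_n<\infty\}$, $X_\infty$ bounded sequences with sup norm. $\mathbf{y}\in M^{\mathbb{Z}}$ is a $\beta$-pseudoorbit if $|f(y_{k-1})-y_k|<\beta$ for all $k$; $\mathbf{x}$ $\rho$-shadows $\mathbf{y}$ if $|x_k-y_k|<\rho$ for all $k$. A set $\Lambda$ is shadowable if there is an increasing sequence of sets $\Lambda_k$ with $\bigcup_k\Lambda_k=\Lambda$ and, for each $k$, a number $\delta_k>0$ such that for every sufficiently small $\rho>0$ there is $\beta>0$ (depending on $\rho,k$) such that whenever $\mathbf{y}$ is a $\beta$-pseudoorbit with every $y_j$ in the $\delta_k$-neighborhood of $\Lambda_k$, there exists $x\in M$ with $o(x)$ $\rho$-shadowing $\mathbf{y}$. *)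

(* Defs.v *)
From mathcomp Require Import all_boot.
From Stdlib Require Import Reals ZArith.

Open Scope R_scope.

Definition vec (d : nat) := 'I_d -> R.
Definition mat (d : nat) := 'I_d -> 'I_d -> R.
Definition ivec (d : nat) := 'I_d -> Z.

Definition vadd {d} (u v : vec d) : vec d := fun i => u i + v i.
Definition vsub {d} (u v : vec d) : vec d := fun i => u i - v i.
Definition vofZ {d} (k : ivec d) : vec d := fun i => IZR (k i).

Definition vnorm {d} (v : vec d) : R := sqrt (\big[Rplus/0]_(i < d) (v i * v i)).

Definition mv {d} (A : mat d) (v : vec d) : vec d :=
  fun i => \big[Rplus/0]_(j < d) (A i j * v j).

(* Torus M = R^d/Z^d: points are represented by vectors of R^d.
   [teq x y] : x and y represent the same point of M. *)
Definition teq {d} (x y : vec d) : Prop := exists k : ivec d, y = vadd x (vofZ k).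

(* [tclose x y r] : the flat distance |x - y| on M is < r
   (i.e. inf_k ||x - y + k|| < r; the inf is attained). *)
Definition tclose {d} (x y : vec d) (r : R) : Prop :=
  exists k : ivec d, vnorm (vadd (vsub x y) (vofZ k)) < r.

Definition torus_set {d} (L : vec d -> Prop) : Prop :=
  forall x k, L x <-> L (vadd x (vofZ k)).

Definition has_deriv {d} (F : vec d -> vec d) (x : vec d) (A : mat d) : Prop :=
  forall eps, 0 < eps -> exists del, 0 < del /\
    forall h : vec d, vnorm h < del ->
      vnorm (vsub (vsub (F (vadd x h)) (F x)) (mv A h)) <= eps * vnorm h.

Definition C1 {d} (F : vec d -> vec d) : Prop :=
  exists DF : vec d -> mat d,
    (forall x, has_deriv F x (DF x)) /\
    (forall x i j eps, 0 < eps -> exists del, 0 < del /\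
       forall y, vnorm (vsub y x) < del -> Rabs (DF y i j - DF x i j) < eps).

Definition descends {d} (F : vec d -> vec d) : Prop :=
  forall x y, teq x y -> teq (F x) (F y).

(* F (a lift of f) is a C^{1+alpha} diffeomorphism of M with derivative DF. *)
Definition C1alpha_diffeo {d} (F : vec d -> vec d) (DF : vec d -> mat d) (alpha : R) : Prop :=
  (forall x, has_deriv F x (DF x)) /\
  (exists C, forall x y i j, x <> y -> vnorm (vsub x y) <= 1 ->
       Rabs (DF x i j - DF y i j) <= C * Rpower (vnorm (vsub x y)) alpha) /\
  descends F /\
  (exists G : vec d -> vec d, C1 G /\ descends G /\
     (forall x, teq (G (F x)) x) /\ (forall x, teq (F (G x)) x)).

Definition f_invariant {d} (F : vec d -> vec d) (L : vec d -> Prop) : Prop :=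
  (forall x, L x -> L (F x)) /\ (forall y, L y -> exists x, L x /\ teq (F x) y).

Definition is_orbit {d} (F : vec d -> vec d) (xs : Z -> vec d) : Prop :=
  forall k : Z, teq (F (xs (k - 1)%Z)) (xs k).

Definition Gamma {d} (DF : vec d -> mat d) (xs : Z -> vec d) (eta : Z -> vec d) : Z -> vec d :=
  fun k => vsub (eta k) (mv (DF (xs (k - 1)%Z)) (eta (k - 1)%Z)).

Inductive nbar := NFin (m : nat) | NInf.

Definition nbar_ok (n : nbar) : Prop :=
  match n with NFin m => (1 <= m)%nat | NInf => True end.

Definition weight (n : nbar) (k : Z) : R :=
  match n with
  | NFin m => exp (- IZR (Z.abs k) / INR m)
  | NInf => 1
  end.

Definition inX {d} (n : nbar) (eta : Z -> vec d) : Prop :=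
  exists B, forall k, weight n k * vnorm (eta k) <= B.

(* ||eta||_n < r   (sup_k e^{-|k|/n}|eta_k| < r) *)
Definition norm_lt {d} (n : nbar) (eta : Z -> vec d) (r : R) : Prop :=
  exists s, s < r /\ forall k, weight n k * vnorm (eta k) <= s.

Definition seqsub {d} (a b : Z -> vec d) : Z -> vec d := fun k => vsub (a k) (b k).

Definition has_cont_inverse {d} (n : nbar) (T : (Z -> vec d) -> (Z -> vec d)) : Prop :=
  (forall eta, inX n eta -> inX n (T eta)) /\
  exists S : (Z -> vec d) -> (Z -> vec d),
    (forall xi, inX n xi -> inX n (S xi)) /\
    (forall xi, inX n xi -> T (S xi) = xi) /\
    (forall eta, inX n eta -> S (T eta) = eta) /\
    (forall xi, inX n xi -> forall eps, 0 < eps -> exists del, 0 < del /\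
       forall xi', inX n xi' -> norm_lt n (seqsub xi xi') del ->
         norm_lt n (seqsub (S xi) (S xi')) eps).

Definition pseudo_orbit {d} (F : vec d -> vec d) (beta : R) (ys : Z -> vec d) : Prop :=
  forall k : Z, tclose (F (ys (k - 1)%Z)) (ys k) beta.

Definition shadowable {d} (F : vec d -> vec d) (L : vec d -> Prop) : Prop :=
  exists Ls : nat -> vec d -> Prop,
    (forall k, torus_set (Ls k)) /\
    (forall k x, Ls k x -> Ls (S k) x) /\
    (forall x, L x <-> exists k, Ls k x) /\
    exists delta : nat -> R, (forall k, 0 < delta k) /\
      forall k, exists rho0, 0 < rho0 /\
        forall rho, 0 < rho < rho0 -> exists beta, 0 < beta /\
          forall ys : Z -> vec d, pseudo_orbit F beta ys ->
            (forall j, exists z, Ls k z /\ tclose (ys j) z (delta k)) ->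
            exists xs, is_orbit F xs /\ forall j, tclose (xs j) (ys j) rho.

(* Main.v *)
(** Let [Lambda_K] be the points of [Lambda] whose operator [Gamma] has inverse of norm at most [K] on
    [X_n]. Perturbing the weight, [Gamma] along such an orbit solves [Gamma v = xi] for bounded [xi]
    with [|v_k| <= K' e^(c1 |k|)] and still satisfies the a priori estimate for a strictly larger rate
    [c2 > c1]. Let [y] be a pseudo-orbit whose points [y_j] are close to [z_j] in [Lambda_K]; by
    uniform continuity of [f] and its inverse, the orbit of [z_j] follows [y] on a long window around
    [j]. Solve the equation along the orbit of each [z_j], and let [w_j] be the value at time [0] of
    the [j]-th solution, so that [|w_j| <= K' sup |xi|]. Two consecutive solutions differ by the
    solution of an equation whose right-hand side is small on the window and is damped outside it by
    the factor [e^(-(c2 - c1) |k|)]; hence [Gamma_y w] is within [1/4 sup |xi|] of [xi]. So Newton's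
    step halves the pseudo-orbit error, and iterating it converges to a true orbit nearby. *)

Require Import Defs.
From HB Require Import structures.
From mathcomp Require Import all_boot.
From Stdlib Require Import Reals ZArith Lra Lia FunctionalExtensionality ClassicalEpsilon.
From Coquelicot Require Compactness.
Open Scope R_scope.

(** * Finite sums, the Euclidean norm and the action of matrices *)

HB.instance Definition _ := Monoid.isComLaw.Build R 0 Rplus
  (fun x y z => esym (Rplus_assoc x y z)) Rplus_comm Rplus_0_l.

Lemma sum_le (I : finType) (f g : I -> R) :
  (forall i, f i <= g i) -> \big[Rplus/0]_i f i <= \big[Rplus/0]_i g i.
Proof.
by move=> h; elim/big_rec2: _ => [|i x y _ hxy]; [lra | have := h i; lra].
Qed.

Lemma sum_scal (I : finType) (c : R) (f : I -> R) :
  \big[Rplus/0]_i (c * f i) = c * \big[Rplus/0]_i f i.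
Proof. by elim/big_rec2: _ => [|i x y _ ->]; ring. Qed.

Lemma sum_ge0 (I : finType) (f : I -> R) :
  (forall i, 0 <= f i) -> 0 <= \big[Rplus/0]_i f i.
Proof. by move=> h; elim/big_rec: _ => [|i x _ hx]; [lra | have := h i; lra]. Qed.

Lemma sum_ge_term (I : finType) (f : I -> R) (i : I) :
  (forall i, 0 <= f i) -> f i <= \big[Rplus/0]_i f i.
Proof.
move=> h; rewrite (bigD1 i) //=.
suff: 0 <= \big[Rplus/0]_(j | j != i) f j by lra.
by elim/big_rec: _ => [|j x _ hx]; [lra | have := h j; lra].
Qed.

Lemma sum_const (d : nat) (c : R) : \big[Rplus/0]_(i < d) c = INR d * c.
Proof.
elim: d => [|d IH]; first by rewrite big_ord0 /=; ring.
by rewrite big_ord_recr /= IH -/(INR d.+1) S_INR; ring.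
Qed.

Lemma sum_Rabs (I : finType) (f : I -> R) :
  Rabs (\big[Rplus/0]_i f i) <= \big[Rplus/0]_i Rabs (f i).
Proof.
elim/big_rec2: _ => [|i x y _ hxy]; first by rewrite Rabs_R0; lra.
by have := Rabs_triang (f i) y; lra.
Qed.

Definition vzero {d} : vec d := fun _ => 0.
Definition vscal {d} (t : R) (v : vec d) : vec d := fun i => t * v i.
Definition msub {d} (A B : mat d) : mat d := fun i j => A i j - B i j.

Lemma vec_eq {d} (u v : vec d) : (forall i, u i = v i) -> u = v.
Proof. exact: functional_extensionality. Qed.

Ltac vring := apply: vec_eq => ?; rewrite /vadd /vsub /vscal /vzero /vofZ; ring.

Lemma sumsq_ge0 {d} (v : vec d) : 0 <= \big[Rplus/0]_(i < d) (v i * v i).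
Proof. by apply: sum_ge0 => i; nra. Qed.

Lemma vnorm_ge0 {d} (v : vec d) : 0 <= vnorm v.
Proof. exact: sqrt_pos. Qed.

Lemma vnorm_sqr {d} (v : vec d) :
  vnorm v * vnorm v = \big[Rplus/0]_(i < d) (v i * v i).
Proof. by rewrite /vnorm sqrt_sqrt //; apply: sumsq_ge0. Qed.

Lemma vnorm_comp {d} (v : vec d) i : Rabs (v i) <= vnorm v.
Proof.
rewrite /vnorm -sqrt_Rsqr_abs; apply: sqrt_le_1_alt; rewrite /Rsqr.
by apply: (sum_ge_term _ (fun i => v i * v i)) => j; nra.
Qed.

(** The sum of squares is at most [d e^2], and this is at most [(d e)^2] because the integer [d] is
    0 or at least 1. *)
Lemma vnorm_le_sup {d} (v : vec d) e :
  0 <= e -> (forall i, Rabs (v i) <= e) -> vnorm v <= INR d * e.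
Proof.
move=> e0 h; have d0 := pos_INR d.
case: (Req_dec (INR d) 0) => hd.
  have d00 : d = 0%nat by apply: INR_eq.
  rewrite /vnorm; subst d; rewrite big_ord0 sqrt_0 /=; lra.
have d1 : 1 <= INR d.
  case: d v h d0 hd => [|d] v h d0 hd; first by case: hd.
  by rewrite S_INR; have := pos_INR d; lra.
rewrite /vnorm -(sqrt_Rsqr (INR d * e)); last by nra.
apply: sqrt_le_1_alt; apply: Rle_trans.
  apply: (sum_le _ _ (fun=> e * e)) => i.
  by apply: Rsqr_le_abs_1; rewrite (Rabs_pos_eq e).
rewrite sum_const /Rsqr; have ee : 0 <= e * e by nra.
have : 0 <= INR d * (INR d - 1) * (e * e) by repeat apply: Rmult_le_pos; lra.
lra.
Qed.

Lemma vnorm_zero {d} : vnorm (@vzero d) = 0.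
Proof.
apply: Rle_antisym; last exact: vnorm_ge0.
have := @vnorm_le_sup d vzero 0 (Rle_refl 0); rewrite Rmult_0_r; apply => i.
by rewrite /vzero Rabs_R0; lra.
Qed.

Lemma vnorm0_eq {d} (v : vec d) : vnorm v <= 0 -> v = vzero.
Proof.
move=> h; apply: vec_eq => i; have := vnorm_comp v i.
by rewrite /vzero; have := Rabs_pos (v i); split_Rabs; lra.
Qed.

Lemma vnorm_scal {d} t (v : vec d) : vnorm (vscal t v) = Rabs t * vnorm v.
Proof.
rewrite /vnorm -sqrt_Rsqr_abs -sqrt_mult_alt; last exact: Rle_0_sqr.
by congr sqrt; rewrite -sum_scal; apply: eq_bigr => i _; rewrite /vscal /Rsqr; ring.
Qed.

Lemma cauchy_schwarz {d} (u v : vec d) :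
  \big[Rplus/0]_(i < d) (u i * v i) <= vnorm u * vnorm v.
Proof.
have hu := vnorm_ge0 u; have hv := vnorm_ge0 v.
have z0 : \big[Rplus/0]_(i < d) 0 = 0 by rewrite sum_const; ring.
case: (Rle_dec (vnorm u) 0) => [h|h].
  rewrite (vnorm0_eq u h) vnorm_zero (eq_bigr (fun=> 0)) ?z0; first lra.
  by move=> i _; rewrite /vzero; ring.
case: (Rle_dec (vnorm v) 0) => [h'|h'].
  rewrite (vnorm0_eq v h') vnorm_zero (eq_bigr (fun=> 0)) ?z0; first lra.
  by move=> i _; rewrite /vzero; ring.
set a := vnorm u in hu h *; set b := vnorm v in hv h' *.
(* Weighted arithmetic-geometric mean inequality in each coordinate; this [s] makes both resulting
   sums equal to [a b / 2]. *)
pose s := b / a; have s0 : 0 < s by apply: Rdiv_lt_0_compat; lra.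
apply: Rle_trans (sum_le _ _ (fun i => (s/2) * (u i * u i) + (/s/2) * (v i * v i)) _) _.
  move=> i.
  have -> : (s/2) * (u i * u i) + (/s/2) * (v i * v i) =
            u i * v i + (s * u i - v i)^2 * (/ s / 2) by field; lra.
  have : 0 < / s by apply: Rinv_0_lt_compat.
  have := pow2_ge_0 (s * u i - v i); nra.
rewrite big_split /= !sum_scal -!vnorm_sqr -/a -/b.
by right; rewrite /s; field; lra.
Qed.

Lemma vnorm_triangle {d} (u v : vec d) : vnorm (vadd u v) <= vnorm u + vnorm v.
Proof.
have hu := vnorm_ge0 u; have hv := vnorm_ge0 v; have huv := vnorm_ge0 (vadd u v).
suff : vnorm (vadd u v) * vnorm (vadd u v) <= (vnorm u + vnorm v) * (vnorm u + vnorm v) by nra.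
rewrite vnorm_sqr /vadd.
rewrite (eq_bigr (fun i => (u i * u i + v i * v i) + 2 * (u i * v i))); last by move=> i _; ring.
rewrite !big_split /= sum_scal -!vnorm_sqr.
apply: (Rle_trans _ (vnorm u * vnorm u + vnorm v * vnorm v + 2 * (vnorm u * vnorm v))); last lra.
by apply: Rplus_le_compat_l; apply: Rmult_le_compat_l; [lra | exact: cauchy_schwarz].
Qed.

Lemma vnorm_subC {d} (u v : vec d) : vnorm (vsub u v) = vnorm (vsub v u).
Proof.
have -> : vsub u v = vscal (-1) (vsub v u) by vring.
by rewrite vnorm_scal Rabs_Ropp Rabs_R1; ring.
Qed.

Lemma vnorm_sub {d} (u v : vec d) : vnorm (vsub u v) <= vnorm u + vnorm v.
Proof.
have -> : vsub u v = vadd u (vscal (-1) v) by vring.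
by have := vnorm_triangle u (vscal (-1) v); rewrite vnorm_scal Rabs_Ropp Rabs_R1; lra.
Qed.

Lemma mv_add {d} (A : mat d) u v : mv A (vadd u v) = vadd (mv A u) (mv A v).
Proof.
apply: vec_eq => i; rewrite /mv /vadd -big_split /=.
by apply: eq_bigr => j _; ring.
Qed.

Lemma mv_scal {d} (A : mat d) t v : mv A (vscal t v) = vscal t (mv A v).
Proof.
apply: vec_eq => i; rewrite /mv /vscal -sum_scal.
by apply: eq_bigr => j _; ring.
Qed.

Lemma mv_sub {d} (A : mat d) u v : mv A (vsub u v) = vsub (mv A u) (mv A v).
Proof.
have -> : vsub u v = vadd u (vscal (-1) v) by vring.
by rewrite mv_add mv_scal; vring.
Qed.

Lemma mv_zero {d} (A : mat d) : mv A vzero = vzero.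
Proof. have -> : @vzero d = vscal 0 vzero by vring. by rewrite mv_scal; vring. Qed.

Lemma mv_msub {d} (A B : mat d) w : mv (msub A B) w = vsub (mv A w) (mv B w).
Proof.
apply: vec_eq => i; rewrite /vsub /Rminus -(Rmult_1_l (- mv B w i)) Ropp_mult_distr_r_reverse.
rewrite Ropp_mult_distr_l /mv -sum_scal -big_split /=.
by apply: eq_bigr => j _; rewrite /msub; ring.
Qed.

Lemma mv_comp_bound {d} (A : mat d) e (w : vec d) i : (forall j, Rabs (A i j) <= e) ->
  Rabs (mv A w i) <= INR d * (e * vnorm w).
Proof.
move=> h; rewrite /mv; apply: Rle_trans (sum_Rabs _ _) _; rewrite -sum_const.
apply: sum_le => j; rewrite Rabs_mult; have := h j; have := vnorm_comp w j.
by have := Rabs_pos (A i j); have := Rabs_pos (w j); nra.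
Qed.

Lemma mv_bound {d} (A : mat d) e (w : vec d) : 0 <= e ->
  (forall i j, Rabs (A i j) <= e) -> vnorm (mv A w) <= INR d * INR d * e * vnorm w.
Proof.
move=> e0 h; have hw := vnorm_ge0 w; have d0 := pos_INR d.
have := @vnorm_le_sup d (mv A w) (INR d * (e * vnorm w)).
rewrite -!Rmult_assoc; apply; first by apply: Rmult_le_pos => //; nra.
by move=> i; rewrite Rmult_assoc; apply: mv_comp_bound.
Qed.

(** * Compactness of the closed fundamental cube *)

Definition cube {d} (x : vec d) : Prop := forall i, 0 <= x i <= 1.

(** Coquelicot states compactness of boxes for nested pairs; the two conversions carry it over to
    functions on ['I_d]. *)
Fixpoint vec_of_tuple {d} : Compactness.Tn d R -> vec d :=
  match d with
  | O => fun _ _ => 0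
  | S n => fun t i =>
      match unlift ord0 i with
      | None => fst t
      | Some j => vec_of_tuple (snd t) j
      end
  end.

Fixpoint tuple_of_vec {d} : vec d -> Compactness.Tn d R :=
  match d with
  | O => fun _ => tt
  | S n => fun v => (v ord0, tuple_of_vec (fun j => v (lift ord0 j)))
  end.

Lemma bounded_tuple_of_vec {d} (x : vec d) : cube x ->
  Compactness.bounded_n d (tuple_of_vec (fun=> 0)) (tuple_of_vec (fun=> 1)) (tuple_of_vec x).
Proof.
elim: d x => [//|d IH] x h /=; split; first exact: h.
by apply: IH => i; apply: h.
Qed.

Lemma close_vec_of_tuple {d} r (x : vec d) (t : Compactness.Tn d R) :
  Compactness.close_n d r (tuple_of_vec x) t -> forall i, Rabs (x i - vec_of_tuple t i) < r.
Proof.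
elim: d x t => [|d IH] x t; first by move=> _ [].
case: t => a t /= [h1 h2] i /=; case: (unliftP ord0 i) => [j|] -> //.
exact: (IH (fun j => x (lift ord0 j))).
Qed.

(** Heine-Borel as an induction principle on sets: finitely many good balls cover the cube and are
    merged one at a time. Uniformity over the torus thereby reduces to a local check. *)
Lemma cube_induction {d} (P : (vec d -> Prop) -> Prop) :
  (forall A B : vec d -> Prop, (forall x, A x -> B x) -> P B -> P A) ->
  P (fun _ => False) ->
  (forall A B, P A -> P B -> P (fun x => A x \/ B x)) ->
  (forall x, exists r, 0 < r /\ P (fun y => vnorm (vsub y x) < r)) ->
  P cube.
Proof.
move=> mono P0 PU loc.
pose rad x := proj1_sig (constructive_indefinite_description _ (loc x)).
have radP x : 0 < rad x /\ P (fun y => vnorm (vsub y x) < rad x).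
  by rewrite /rad; case: constructive_indefinite_description.
have dpos : 0 < INR d + 1 by have := pos_INR d; lra.
(* The cover is measured coordinatewise; dividing by [d + 1] gives a strict Euclidean inequality. *)
have gpos x : 0 < rad x / (INR d + 1) by apply: Rdiv_lt_0_compat => //; case: (radP x).
(* The finite cover is available under a double negation, so the goal is first turned into a
   contradiction. *)
apply: NNPP => nP.
apply: (Compactness.compactness_list d (tuple_of_vec (fun=> 0)) (tuple_of_vec (fun=> 1))
  (fun t => mkposreal _ (gpos (vec_of_tuple t)))) => -[l lP]; apply: nP.
apply: (mono _ (fun x => exists t, List.In t l /\
   vnorm (vsub x (vec_of_tuple t)) < rad (vec_of_tuple t))).
  move=> x cx; have [t [tl [bt ct]]] := lP _ (bounded_tuple_of_vec x cx).
  exists t; split=> //; have h := close_vec_of_tuple _ _ _ ct.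
  have g := gpos (vec_of_tuple t); have [r0 _] := radP (vec_of_tuple t).
  apply: Rle_lt_trans (vnorm_le_sup _ _ (Rlt_le _ _ g) _) _.
    by move=> i; apply: Rlt_le; apply: h.
  have -> : INR d * (rad (vec_of_tuple t) / (INR d + 1)) =
     rad (vec_of_tuple t) - rad (vec_of_tuple t) / (INR d + 1) by field; lra.
  lra.
elim: l {lP} => [|t l IH]; first by apply: mono P0 => x [t [[]]].
apply: mono (PU _ _ (proj2 (radP (vec_of_tuple t))) IH) => x [s [[<-|sl] h]]; first by left.
by right; exists s.
Qed.

(** * Integer translations and pointwise derivatives *)

Lemma int_part_cube {d} (x : vec d) : exists k : ivec d, cube (vadd x (vofZ k)).
Proof.
exists (fun i => (- Int_part (x i))%Z) => i; rewrite /vadd /vofZ opp_IZR.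
by have := base_Int_part (x i); lra.
Qed.

Lemma vofZ_small {d} (k : ivec d) : vnorm (vofZ k) < 1 -> k = fun=> 0%Z.
Proof.
move=> h; apply: functional_extensionality => i.
have := vnorm_comp (vofZ k) i; rewrite /vofZ -abs_IZR => h'.
have : IZR (Z.abs (k i)) < 1 by exact: Rle_lt_trans h' h.
by move/lt_IZR; lia.
Qed.

Lemma has_deriv_unique {d} (F : vec d -> vec d) x A B :
  has_deriv F x A -> has_deriv F x B -> A = B.
Proof.
move=> hA hB; suff h w : vnorm (mv (msub A B) w) <= 0.
  apply: functional_extensionality => i; apply: functional_extensionality => j.
  pose e : vec d := fun k => if k == j then 1 else 0.
  have := f_equal (fun v => v i) (vnorm0_eq _ (h e)).
  rewrite /mv (bigD1 j) //= big1 => [|k kj]; last by rewrite /e (negbTE kj); ring.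
  by rewrite /e eqxx /msub /vzero; lra.
apply: Rnot_lt_le => pos.
have nw := vnorm_ge0 w.
(* With this [eps] the two linearization errors at [t w] add up to at most half of [|t (A - B) w|],
   although their difference equals that vector. *)
pose eps := vnorm (mv (msub A B) w) / (4 * (vnorm w + 1)).
have epos : 0 < eps by apply: Rdiv_lt_0_compat; lra.
have [da [da0 ha]] := hA eps epos; have [db [db0 hb]] := hB eps epos.
pose t := Rmin da db / (2 * (vnorm w + 1)).
have mpos : 0 < Rmin da db by exact: Rmin_pos.
have tpos : 0 < t by apply: Rdiv_lt_0_compat; lra.
have tw : vnorm (vscal t w) = t * vnorm w by rewrite vnorm_scal Rabs_pos_eq //; lra.
have tE : t * (vnorm w + 1) = Rmin da db / 2 by rewrite /t; field; lra.
have small : vnorm (vscal t w) < Rmin da db by rewrite tw; nra.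
have := ha _ (Rlt_le_trans _ _ _ small (Rmin_l _ _)).
have := hb _ (Rlt_le_trans _ _ _ small (Rmin_r _ _)).
set D := vsub (F _) _ => h1 h2.
have := vnorm_sub (vsub D (mv B (vscal t w))) (vsub D (mv A (vscal t w))).
have -> : vsub (vsub D (mv B (vscal t w))) (vsub D (mv A (vscal t w))) =
          vscal t (mv (msub A B) w) by rewrite mv_msub !mv_scal; vring.
rewrite vnorm_scal (Rabs_pos_eq t); last lra.
have eE : eps * (vnorm w + 1) = vnorm (mv (msub A B) w) / 4 by rewrite /eps; field; lra.
rewrite tw in h1 h2.
have : eps * (t * vnorm w) <= t * (vnorm (mv (msub A B) w) / 4) by rewrite -eE; nra.
by nra.
Qed.

Lemma mv_matrix_bound {d} (A : mat d) : exists C, 0 <= C /\ forall w, vnorm (mv A w) <= C * vnorm w.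
Proof.
have [C hC] : exists C, forall i j, Rabs (A i j) <= C.
  exists (\big[Rplus/0]_i \big[Rplus/0]_j Rabs (A i j)) => i j.
  apply: Rle_trans (sum_ge_term _ (fun j => Rabs (A i j)) j _) _; first by move=> *; apply: Rabs_pos.
  apply: (sum_ge_term _ (fun i => \big[Rplus/0]_j Rabs (A i j)) i) => k.
  by apply: sum_ge0 => *; apply: Rabs_pos.
have d0 := pos_INR d.
exists (INR d * INR d * Rabs C); split; first by have := Rabs_pos C; nra.
move=> w; apply: mv_bound; first exact: Rabs_pos.
by move=> i j; apply: Rle_trans (hC i j) (Rle_abs _).
Qed.

Lemma has_deriv_continuous {d} (F : vec d -> vec d) x A : has_deriv F x A ->
  forall eps, 0 < eps -> exists del, 0 < del /\
    forall y, vnorm (vsub y x) < del -> vnorm (vsub (F y) (F x)) < eps.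
Proof.
move=> h eps e0; have [r [r0 hr]] := h 1 Rlt_0_1.
have [C [C0 hC]] := mv_matrix_bound A.
have q : 0 < eps / (C + 2) by apply: Rdiv_lt_0_compat; lra.
exists (Rmin r (eps / (C + 2))); split; first exact: Rmin_pos.
move=> y hy; have y0 := vnorm_ge0 (vsub y x).
have := hr _ (Rlt_le_trans _ _ _ hy (Rmin_l _ _)).
have -> : vadd x (vsub y x) = y by vring.
have := Rlt_le_trans _ _ _ hy (Rmin_r _ _) => hy2.
move=> h1; have := hC (vsub y x) => h2.
have -> : vsub (F y) (F x) = vadd (vsub (vsub (F y) (F x)) (mv A (vsub y x))) (mv A (vsub y x)) by vring.
apply: Rle_lt_trans (vnorm_triangle _ _) _.
have : (C + 2) * (eps / (C + 2)) = eps by field; lra.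
nra.
Qed.

(** [F (x + k) - F x] is an integer vector and depends continuously on [x], so it is locally
    constant. The increments of [F] at [x] and at [x + k] agree, and uniqueness of the derivative
    applies. *)
Lemma deriv_periodic {d} (F : vec d -> vec d) (DF : vec d -> mat d) :
  (forall x, has_deriv F x (DF x)) -> descends F ->
  forall x k, DF (vadd x (vofZ k)) = DF x.
Proof.
move=> hD hd x k; apply: (has_deriv_unique F x) => //.
have [p hp] := hd x (vadd x (vofZ k)) (ex_intro _ k erefl).
(* Two increments below 1/2 make the integer vector [q - p] shorter than 1, hence zero. *)
have [r [r0 hr]] := has_deriv_continuous F x _ (hD x) (1/2) ltac:(lra).
have [r' [r'0 hr']] := has_deriv_continuous F _ _ (hD (vadd x (vofZ k))) (1/2) ltac:(lra).
move=> eps e0; have [s [s0 hs]] := hD (vadd x (vofZ k)) eps e0.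
exists (Rmin s (Rmin r r')); split; first by do 2 apply: Rmin_pos => //.
move=> h hh; have hr1 := Rlt_le_trans _ _ _ hh (Rmin_r _ _).
have := hs h (Rlt_le_trans _ _ _ hh (Rmin_l _ _)).
suff -> : vsub (F (vadd (vadd x (vofZ k)) h)) (F (vadd x (vofZ k))) =
          vsub (F (vadd x h)) (F x) by [].
have [q hq] : teq (F (vadd x h)) (F (vadd (vadd x (vofZ k)) h)).
  by apply: hd; exists k; vring.
have : (fun i => (q i - p i)%Z) = (fun=> 0%Z) :> ivec d.
  apply: vofZ_small.
  have -> : vofZ (fun i => (q i - p i)%Z) =
      vsub (vsub (F (vadd (vadd x (vofZ k)) h)) (F (vadd x (vofZ k)))) (vsub (F (vadd x h)) (F x)).
    by rewrite hq hp; apply: vec_eq => i; rewrite /vsub /vadd /vofZ minus_IZR; ring.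
  apply: Rle_lt_trans (vnorm_sub _ _) _.
  have := hr (vadd x h); have := hr' (vadd (vadd x (vofZ k)) h).
  have -> : vsub (vadd (vadd x (vofZ k)) h) (vadd x (vofZ k)) = h by vring.
  have -> : vsub (vadd x h) x = h by vring.
  have := Rlt_le_trans _ _ _ hr1 (Rmin_l _ _); have := Rlt_le_trans _ _ _ hr1 (Rmin_r _ _).
  by move=> a b /(_ a) c /(_ b) e; lra.
move=> qp; rewrite hq hp; apply: vec_eq => i; rewrite /vsub /vadd /vofZ.
have := f_equal (fun g => g i) qp => /= qpi.
have -> : q i = p i by lia.
ring.
Qed.

(** * The flat distance and equality of points on the torus *)

Lemma tclose_sym {d} (x y : vec d) r : tclose x y r -> tclose y x r.
Proof.
move=> [k h]; exists (fun i => (- k i)%Z).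
have -> : vadd (vsub y x) (vofZ (fun i => (- k i)%Z)) = vscal (-1) (vadd (vsub x y) (vofZ k)).
  by apply: vec_eq => i; rewrite /vsub /vadd /vofZ /vscal opp_IZR; ring.
by rewrite vnorm_scal Rabs_Ropp Rabs_R1 Rmult_1_l.
Qed.

Lemma tclose_trans {d} (x y z : vec d) r s :
  tclose x y r -> tclose y z s -> tclose x z (r + s).
Proof.
move=> [k h] [l h']; exists (fun i => (k i + l i)%Z).
have -> : vadd (vsub x z) (vofZ (fun i => (k i + l i)%Z)) =
   vadd (vadd (vsub x y) (vofZ k)) (vadd (vsub y z) (vofZ l)).
  by apply: vec_eq => i; rewrite /vsub /vadd /vofZ plus_IZR; ring.
by have := vnorm_triangle (vadd (vsub x y) (vofZ k)) (vadd (vsub y z) (vofZ l)); lra.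
Qed.

Lemma tclose_le {d} (x y : vec d) r s : r <= s -> tclose x y r -> tclose x y s.
Proof. by move=> rs [k h]; exists k; lra. Qed.

Lemma tclose_vnorm {d} (x y : vec d) r : vnorm (vsub x y) < r -> tclose x y r.
Proof.
move=> h; exists (fun=> 0%Z).
by have -> : vadd (vsub x y) (vofZ (fun=> 0%Z)) = vsub x y by vring.
Qed.

Lemma tcloseE {d} (x y : vec d) r : tclose x y r ->
  exists x', teq x x' /\ vnorm (vsub x' y) < r.
Proof.
move=> [k h]; exists (vadd x (vofZ k)); split; first by exists k.
by have -> : vsub (vadd x (vofZ k)) y = vadd (vsub x y) (vofZ k) by vring.
Qed.

Lemma teq_sym {d} (x y : vec d) : teq x y -> teq y x.
Proof.
move=> [k ->]; exists (fun i => (- k i)%Z).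
by apply: vec_eq => i; rewrite /vadd /vofZ opp_IZR; ring.
Qed.

Lemma teq_refl {d} (x : vec d) : teq x x.
Proof. by exists (fun=> 0%Z); vring. Qed.

Lemma teq_trans {d} (x y z : vec d) : teq x y -> teq y z -> teq x z.
Proof.
move=> [k ->] [l ->]; exists (fun i => (k i + l i)%Z).
by apply: vec_eq => i; rewrite /vadd /vofZ plus_IZR; ring.
Qed.

Lemma teq_tclose {d} (x x' y y' : vec d) r :
  teq x x' -> teq y y' -> tclose x y r -> tclose x' y' r.
Proof.
move=> [k ->] [l ->] [p h]; exists (fun i => (p i - k i + l i)%Z).
have -> : vadd (vsub (vadd x (vofZ k)) (vadd y (vofZ l))) (vofZ (fun i => (p i - k i + l i)%Z)) =
   vadd (vsub x y) (vofZ p) by apply: vec_eq => i; rewrite /vadd /vsub /vofZ plus_IZR minus_IZR; ring.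
by [].
Qed.

(** * Uniformity on the torus *)

Definition tuniform {d} (G : vec d -> vec d) : Prop :=
  forall eps, 0 < eps -> exists del, 0 < del /\
    forall x y, tclose x y del -> tclose (G x) (G y) eps.

Lemma continuous_tuniform {d} (G : vec d -> vec d) : descends G ->
  (forall x eps, 0 < eps -> exists del, 0 < del /\
     forall y, vnorm (vsub y x) < del -> vnorm (vsub (G y) (G x)) < eps) ->
  tuniform G.
Proof.
move=> hd hc eps e0.
(* Only the centre [x] is confined to the cube; the neighbour [y] is arbitrary, so pairs straddling
   the boundary are covered. *)
have [del [d0 h]] : exists del, 0 < del /\ forall x, cube x ->
    forall y, vnorm (vsub y x) < del -> vnorm (vsub (G y) (G x)) < eps.
  apply: (cube_induction (fun S => exists del, 0 < del /\ forall x, S x ->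
    forall y, vnorm (vsub y x) < del -> vnorm (vsub (G y) (G x)) < eps)).
  - by move=> A B AB [del [d0 h]]; exists del; split=> // x /AB; apply: h.
  - by exists 1; split; [lra | ].
  - move=> A B [a [a0 ha]] [b [b0 hb]]; exists (Rmin a b); split; first exact: Rmin_pos.
    move=> x [Ax|Bx] y hy.
      by apply: ha => //; apply: Rlt_le_trans hy (Rmin_l _ _).
    by apply: hb => //; apply: Rlt_le_trans hy (Rmin_r _ _).
  - move=> x; have [r [r0 hr]] := hc x (eps/2) ltac:(lra).
    exists (r/2); split; first lra; exists (r/2); split; first lra.
    move=> y hy z hz.
    have -> : vsub (G z) (G y) = vsub (vsub (G z) (G x)) (vsub (G y) (G x)) by vring.
    have h1 := hr y ltac:(lra).
    have h2 : vnorm (vsub (G z) (G x)) < eps/2.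
      apply: hr; have -> : vsub z x = vadd (vsub z y) (vsub y x) by vring.
      by have := vnorm_triangle (vsub z y) (vsub y x); lra.
    by have := vnorm_sub (vsub (G z) (G x)) (vsub (G y) (G x)); lra.
exists del; split=> // x y hxy.
have [k ck] := int_part_cube y.
have hxy' : tclose x (vadd y (vofZ k)) del.
  by apply: teq_tclose hxy; [exact: teq_refl | exists k].
have [x' [ex hx]] := tcloseE _ _ _ hxy'.
apply: (teq_tclose (G x') _ (G (vadd y (vofZ k)))).
- exact: teq_sym (hd _ _ ex).
- by apply: teq_sym; apply: hd; exists k.
- by apply: tclose_vnorm; apply: h.
Qed.

(** The form in which the Holder condition enters: a modulus of continuity of [DF] for the torus
    distance, in operator norm. *)
Definition deriv_uniform {d} (DF : vec d -> mat d) : Prop :=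
  forall eps, 0 < eps -> exists del, 0 < del /\
    forall x y, tclose x y del -> forall w, vnorm (mv (msub (DF x) (DF y)) w) <= eps * vnorm w.

Lemma holder_deriv_uniform {d} (DF : vec d -> mat d) C alpha : 0 < alpha ->
  (forall x k, DF (vadd x (vofZ k)) = DF x) ->
  (forall x y i j, x <> y -> vnorm (vsub x y) <= 1 ->
     Rabs (DF x i j - DF y i j) <= C * Rpower (vnorm (vsub x y)) alpha) ->
  deriv_uniform DF.
Proof.
move=> al0 per hol eps e0.
have d0 := pos_INR d.
pose e1 := eps / (INR d * INR d + 1).
have e1p : 0 < e1 by apply: Rdiv_lt_0_compat => //; nra.
have C1 : 0 < Rabs C + 1 by have := Rabs_pos C; lra.
pose q := e1 / (Rabs C + 1).
have q0 : 0 < q by apply: Rdiv_lt_0_compat.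
have qE : (Rabs C + 1) * q = e1 by rewrite /q; field; lra.
(* Solves [(|C| + 1) del^alpha = e1]; [|C| + 1] replaces [C], which may be zero or negative. *)
pose del := Rpower q (/ alpha).
have del0 : 0 < del by exact: exp_pos.
exists (Rmin 1 del); split; first by apply: Rmin_pos; lra.
move=> x y hxy w.
have [x' [[k ex] hx]] := tcloseE _ _ _ hxy.
have -> : DF x = DF x' by rewrite ex per.
have ent i j : Rabs (msub (DF x') (DF y) i j) <= e1.
  (* [Rpower] takes a default value at base 0, so the Holder bound covers distinct points and
     equality is treated apart. *)
  case: (excluded_middle_informative (x' = y)) => [->|ne].
    by rewrite /msub Rminus_diag Rabs_R0; lra.
  have l1 := Rlt_le_trans _ _ _ hx (Rmin_l _ _).
  have l2 := Rlt_le_trans _ _ _ hx (Rmin_r _ _).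
  apply: Rle_trans (hol x' y i j ne (Rlt_le _ _ l1)) _.
  have n0 : 0 < vnorm (vsub x' y).
    apply: Rnot_le_lt => /vnorm0_eq h; apply: ne; apply: vec_eq => m.
    by have := f_equal (fun g => g m) h; rewrite /vsub /vzero; lra.
  have : Rpower (vnorm (vsub x' y)) alpha <= q.
    have <- : Rpower del alpha = q.
      by rewrite /del Rpower_mult Rinv_l; [apply: Rpower_1 | lra].
    by apply: Rle_Rpower_l; [lra | split; lra].
  have := exp_pos (alpha * ln (vnorm (vsub x' y))); rewrite -/(Rpower _ _) => p0 p1.
  have := Rle_abs C; have := Rabs_pos C; nra.
apply: Rle_trans (mv_bound _ _ w (Rlt_le _ _ e1p) ent) _.
apply: Rmult_le_compat_r; first exact: vnorm_ge0.
have : (INR d * INR d + 1) * e1 = eps by rewrite /e1; field; nra.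
lra.
Qed.

(** A bound at one centre plus the uniform modulus gives a bound on a ball; compactness and
    periodicity do the rest. *)
Lemma deriv_bounded {d} (DF : vec d -> mat d) :
  (forall x k, DF (vadd x (vofZ k)) = DF x) -> deriv_uniform DF ->
  exists B, 0 < B /\ forall x w, vnorm (mv (DF x) w) <= B * vnorm w.
Proof.
move=> per unif.
have [del [del0 hdel]] := unif 1 Rlt_0_1.
have [B [B0 hB]] : exists B, 0 < B /\ forall x, cube x -> forall w, vnorm (mv (DF x) w) <= B * vnorm w.
  apply: (cube_induction (fun S => exists B, 0 < B /\ forall x, S x ->
    forall w, vnorm (mv (DF x) w) <= B * vnorm w)).
  - by move=> A B AB [C [C0 h]]; exists C; split=> // x /AB; apply: h.
  - by exists 1; split; [lra | ].
  - move=> A B [a [a0 ha]] [b [b0 hb]]; exists (a + b); split; first lra.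
    by move=> x [/ha h|/hb h] w; have := h w; have := vnorm_ge0 w; nra.
  - move=> x; have [C [C0 hC]] := mv_matrix_bound (DF x).
    exists del; split=> //; exists (1 + C); split; first lra.
    move=> y hy w; have := hdel y x (tclose_vnorm _ _ _ hy) w; have := hC w.
    have -> : mv (DF y) w = vadd (mv (msub (DF y) (DF x)) w) (mv (DF x) w).
      by rewrite mv_msub; vring.
    by have := vnorm_triangle (mv (msub (DF y) (DF x)) w) (mv (DF x) w); lra.
exists B; split=> // x w; have [k ck] := int_part_cube x.
by rewrite -(per x k); apply: hB.
Qed.

(** * Uniform first-order expansion *)

Lemma has_deriv_line {d} (F : vec d -> vec d) (DF : vec d -> mat d) x w i t :
  (forall x, has_deriv F x (DF x)) ->
  derivable_pt_lim (fun s => F (vadd x (vscal s w)) i) t (mv (DF (vadd x (vscal t w))) w i).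
Proof.
move=> hD eps e0; have w0 := vnorm_ge0 w.
have e1 : 0 < eps / (2 * (vnorm w + 1)) by apply: Rdiv_lt_0_compat; lra.
have [r [r0 hr]] := hD (vadd x (vscal t w)) _ e1.
have q0 : 0 < r / (vnorm w + 1) by apply: Rdiv_lt_0_compat; lra.
exists (mkposreal _ q0) => h hn /= hh.
have hp : 0 < Rabs h by apply: Rabs_pos_lt.
have hsm : vnorm (vscal h w) < r.
  rewrite vnorm_scal; have : r / (vnorm w + 1) * (vnorm w + 1) = r by field; lra.
  by nra.
have := hr _ hsm; rewrite mv_scal vnorm_scal.
have -> : vadd (vadd x (vscal t w)) (vscal h w) = vadd x (vscal (t + h) w) by vring.
set D := vsub _ _ => hD1; have := Rle_trans _ _ _ (vnorm_comp D i) hD1.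
have -> : D i = h * ((F (vadd x (vscal (t + h) w)) i - F (vadd x (vscal t w)) i) / h
                   - mv (DF (vadd x (vscal t w))) w i).
  by rewrite /D /vsub /vscal; field.
rewrite Rabs_mult => hD2.
apply: (Rmult_lt_reg_l (Rabs h)) => //; apply: Rle_lt_trans hD2 _.
have -> : eps / (2 * (vnorm w + 1)) * (Rabs h * vnorm w) =
   Rabs h * (eps * (vnorm w / (2 * (vnorm w + 1)))) by field; lra.
have : vnorm w / (2 * (vnorm w + 1)) < 1.
  by apply: (Rmult_lt_reg_r (2 * (vnorm w + 1))); [lra | rewrite /Rdiv Rmult_assoc Rinv_l; lra].
move=> lt1; apply: Rmult_lt_compat_l => //; nra.
Qed.

(** The mean value theorem for each coordinate of [F (x + s w) - s DF(x) w] bounds the remainder by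
    the oscillation of [DF] along the segment. Working with [eps / (d + 1)] absorbs the factor [d]
    of the coordinatewise bound. *)
Lemma taylor_uniform {d} (F : vec d -> vec d) (DF : vec d -> mat d) :
  (forall x, has_deriv F x (DF x)) -> deriv_uniform DF ->
  forall eps, 0 < eps -> exists r, 0 < r /\ forall x w, vnorm w < r ->
    vnorm (vsub (vsub (F (vadd x w)) (F x)) (mv (DF x) w)) <= eps * vnorm w.
Proof.
move=> hD unif eps e0; have d0 := pos_INR d.
have e1 : 0 < eps / (INR d + 1) by apply: Rdiv_lt_0_compat; lra.
have [r [r0 hr]] := unif _ e1; exists r; split=> // x w hw.
have w0 := vnorm_ge0 w.
have e2 : 0 <= eps / (INR d + 1) * vnorm w by apply: Rmult_le_pos; lra.
apply: Rle_trans (vnorm_le_sup _ _ e2 _) _; last first.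
  have -> : eps * vnorm w = INR d * (eps / (INR d + 1) * vnorm w) + eps / (INR d + 1) * vnorm w.
    by field; lra.
  lra.
move=> i.
have [c [gc c01]] : exists c, (F (vadd x (vscal 1 w)) i - 1 * mv (DF x) w i) -
    (F (vadd x (vscal 0 w)) i - 0 * mv (DF x) w i) =
    (mv (DF (vadd x (vscal c w))) w i - mv (DF x) w i) * (1 - 0) /\ 0 < c < 1.
  apply: (MVT_cor2 (fun s => F (vadd x (vscal s w)) i - s * mv (DF x) w i)
     (fun c => mv (DF (vadd x (vscal c w))) w i - mv (DF x) w i)) => [|c _]; first lra.
  apply: derivable_pt_lim_minus; first exact: has_deriv_line.
  have := derivable_pt_lim_mult id (fct_cte (mv (DF x) w i)) c _ _
    (derivable_pt_lim_id c) (derivable_pt_lim_const _ c).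
  by rewrite /fct_cte /id /mult_fct Rmult_0_r Rmult_1_l Rplus_0_r.
move: gc; have -> : vadd x (vscal 1 w) = vadd x w by vring.
have -> : vadd x (vscal 0 w) = x by vring.
move=> gc.
have -> : vsub (vsub (F (vadd x w)) (F x)) (mv (DF x) w) i =
   mv (msub (DF (vadd x (vscal c w))) (DF x)) w i.
  by rewrite mv_msub /vsub; lra.
apply: Rle_trans (vnorm_comp _ i) _; apply: hr; apply: tclose_vnorm.
have -> : vsub (vadd x (vscal c w)) x = vscal c w by vring.
by rewrite vnorm_scal Rabs_pos_eq; nra.
Qed.

Lemma has_deriv_tuniform {d} (F : vec d -> vec d) (DF : vec d -> mat d) :
  (forall x, has_deriv F x (DF x)) -> descends F -> tuniform F.
Proof.
move=> hD hd; apply: continuous_tuniform => // x; exact: has_deriv_continuous (hD x).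
Qed.

(** * Orbits and their tracking of pseudo-orbits on finite windows *)

Lemma orbit_exists {d} (F G : vec d -> vec d) (x : vec d) :
  (forall x, teq (F (G x)) x) -> exists xs, is_orbit F xs /\ teq (xs 0%Z) x.
Proof.
move=> FG.
exists (fun k => if (0 <=? k)%Z then ssrnat.iter (Z.to_nat k) F x else ssrnat.iter (Z.to_nat (- k)) G x).
split; last exact: teq_refl.
move=> k; case: (Z.leb_spec 0 (k - 1)) => h1; case: (Z.leb_spec 0 k) => h2; try lia.
- have -> : Z.to_nat k = (Z.to_nat (k - 1)).+1 by lia.
  exact: teq_refl.
- have -> : k = 0%Z by lia.
  exact: FG.
- have -> : Z.to_nat (- (k - 1)) = (Z.to_nat (- k)).+1 by lia.
  exact: FG.
Qed.

(** Induction on the window: one more step forward uses uniform continuity of [F], one more step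
    backward that of [G], and each adds one jump of the pseudo-orbit. *)
Lemma pseudo_orbit_track {d} (F G : vec d -> vec d) :
  tuniform F -> tuniform G -> descends G -> (forall x, teq (G (F x)) x) ->
  forall (N : nat) eps, 0 < eps -> exists del, 0 < del /\
    forall ys zs j, pseudo_orbit F del ys -> is_orbit F zs -> tclose (ys j) (zs 0%Z) del ->
    forall m, (Z.abs m <= Z.of_nat N)%Z -> tclose (ys (j + m)%Z) (zs m) eps.
Proof.
move=> uF uG dG GF; elim=> [|N IH] eps e0.
  exists eps; split=> // ys zs j _ _ h m hm.
  have -> : m = 0%Z by lia.
  by rewrite Z.add_0_r.
have [a [a0 ha]] := uF (eps/2) ltac:(lra); have [b [b0 hb]] := uG (eps/2) ltac:(lra).
pose e := Rmin eps (Rmin a b).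
have ep : 0 < e by do 2 apply: Rmin_pos => //.
have [del [del0 hdel]] := IH e ep.
(* [del] serves the inner window, [eps/2] the jump in the forward step, and [b] the jump in the
   backward step, where [G] is applied to it. *)
pose D := Rmin del (Rmin (eps/2) b).
have Dp : 0 < D by do 2 apply: Rmin_pos => //; lra.
have [Dd [De Db]] : D <= del /\ D <= eps/2 /\ D <= b.
  have := Rmin_l del (Rmin (eps/2) b); have := Rmin_r del (Rmin (eps/2) b).
  by have := Rmin_l (eps/2) b; have := Rmin_r (eps/2) b; rewrite -/D; lra.
have [ee [ea eb]] : e <= eps /\ e <= a /\ e <= b.
  have := Rmin_l eps (Rmin a b); have := Rmin_r eps (Rmin a b).
  by have := Rmin_l a b; have := Rmin_r a b; rewrite -/e; lra.
exists D; split=> // ys zs j py oz hj m hm.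
have near k : (Z.abs k <= Z.of_nat N)%Z -> tclose (ys (j + k)%Z) (zs k) e.
  apply: hdel => //; last exact: tclose_le Dd hj.
  by move=> i; apply: tclose_le Dd _; exact: py.
case: (Z.le_gt_cases (Z.abs m) (Z.of_nat N)) => hN; first exact: tclose_le ee (near m hN).
case: (Z.le_gt_cases 0 m) => hm0.
- have h1 := near (m - 1)%Z ltac:(lia).
  have h2 := ha _ _ (tclose_le _ _ _ _ ea h1).
  have h3 := py (j + m)%Z; have h4 := oz m.
  have -> : eps = eps/2 + eps/2 by lra.
  apply: (tclose_trans _ (F (ys (j + (m - 1))%Z))).
    apply: tclose_le De _; apply: tclose_sym.
    by have -> : (j + (m - 1) = j + m - 1)%Z by lia.
  exact: teq_tclose (teq_refl _) h4 h2.
- have h1 := near (m + 1)%Z ltac:(lia).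
  have h2 := hb _ _ (tclose_le _ _ _ _ eb h1).
  have h3 := py (j + (m + 1))%Z; have h4 := oz (m + 1)%Z.
  rewrite (_ : (j + (m + 1) - 1 = j + m)%Z) in h3; last lia.
  rewrite (_ : (m + 1 - 1 = m)%Z) in h4; last lia.
  have -> : eps = eps/2 + eps/2 by lra.
  apply: (tclose_trans _ (G (ys (j + (m + 1))%Z))).
    have h5 := hb _ _ (tclose_le _ _ _ _ Db h3).
    exact: teq_tclose (GF _) (teq_refl _) h5.
  apply: teq_tclose (teq_refl _) _ h2.
  apply: teq_trans (GF (zs m)); apply: dG; exact: teq_sym.
Qed.

(** * Change of weight *)

(** [Gamma] for an arbitrary matrix sequence; [A k] maps index [k - 1] to index [k], so along an
    orbit it is [DF (xs (k - 1))]. *)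
Definition gam {d} (A : Z -> mat d) (eta : Z -> vec d) : Z -> vec d :=
  fun k => vsub (eta k) (mv (A k) (eta (k - 1)%Z)).

(** The norm of [X_n] with [1/n] replaced by a real rate [c], which can be varied continuously. *)
Definition wbound {d} (c : R) (eta : Z -> vec d) (D : R) : Prop :=
  forall k, exp (- (c * IZR (Z.abs k))) * vnorm (eta k) <= D.

Definition mulseq {d} (m : Z -> R) (eta : Z -> vec d) : Z -> vec d :=
  fun k => vscal (m k) (eta k).

(** Invertibility with inverse bounded by [K], as surjectivity plus an a priori estimate;
    injectivity is its case [D = 0]. *)
Definition invertible_on {d} (A : Z -> mat d) (c K : R) : Prop :=
  (forall xi, (exists D, wbound c xi D) ->
     exists v, (exists D, wbound c v D) /\ forall k, gam A v k = xi k) /\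
  (forall eta D, (exists D', wbound c eta D') -> wbound c (gam A eta) D ->
     wbound c eta (K * D)).

(** Used with [c1 < c2]: solutions grow at the slower rate while the estimate at time 0 tolerates
    the faster one, so what happens far from time 0 is negligible. *)
Definition gap_invertible {d} (A : Z -> mat d) (c1 c2 K : R) : Prop :=
  (forall xi D, (forall k, vnorm (xi k) <= D) ->
     exists v, (forall k, gam A v k = xi k) /\
       forall k, vnorm (v k) <= K * exp (c1 * IZR (Z.abs k)) * D) /\
  (forall eta D, (exists D', wbound c2 eta D') -> wbound c2 (gam A eta) D ->
     vnorm (eta 0%Z) <= K * D).

(** The supremum [s] satisfies [s <= a + s/2]; its finiteness permits subtracting [s/2]. *)
Lemma sup_absorb (f : Z -> R) a :
  (exists b, forall k, f k <= b) ->
  (forall b, (forall k, f k <= b) -> forall k, f k <= a + b / 2) ->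
  forall k, f k <= 2 * a.
Proof.
move=> [b hb] h.
have [||s [s1 s2]] := completeness (fun x => exists k, x = f k).
- by exists b => x [k ->].
- by exists (f 0%Z), 0%Z.
have fs k : f k <= s by apply: s1; exists k.
have : s <= a + s/2 by apply: s2 => x [k ->]; apply: h.
by move=> hs k; have := fs k; lra.
Qed.

Lemma exp_le (x y : R) : x <= y -> exp x <= exp y.
Proof. by case=> [h|->]; [apply: Rlt_le; apply: exp_increasing | right]. Qed.

Lemma exp_diff_le s t eps : Rabs (s - t) <= eps -> Rabs (exp s - exp t) <= (exp eps - 1) * exp t.
Proof.
move=> h.
have -> : exp s - exp t = (exp (s - t) - 1) * exp t.
  by rewrite Rmult_minus_distr_r -exp_plus; do 2 f_equal; ring.
have pt := exp_pos t.
rewrite Rabs_mult (Rabs_pos_eq (exp t)); last lra.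
apply: Rmult_le_compat_r; first lra.
have h1 : exp (s - t) <= exp eps by apply: exp_le; split_Rabs; lra.
have h2 : exp (- eps) <= exp (s - t) by apply: exp_le; split_Rabs; lra.
have : exp eps * exp (- eps) = 1 by rewrite -exp_plus Rplus_opp_r exp_0.
have := exp_pos eps; have := exp_pos (- eps) => p1 p2 p3.
have : 2 <= exp eps + exp (- eps) by have := pow2_ge_0 (exp eps - exp (- eps)); nra.
by split_Rabs; lra.
Qed.

(** Chooses the change of rate: small enough for the perturbation to be absorbed with factor 1/2,
    and at most [c] so that [c - eps] stays nonnegative. *)
Lemma exp_margin (P c : R) : 0 < P -> 0 < c ->
  exists eps, 0 < eps <= c /\ P * (exp eps - 1) <= 1 / 2.
Proof.
move=> P0 c0.
have q : 0 < / (2 * P) by apply: Rinv_0_lt_compat; lra.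
have l0 : 0 < ln (1 + / (2 * P)) by rewrite -ln_1; apply: ln_increasing; lra.
exists (Rmin c (ln (1 + / (2 * P)))); split.
  by split; [apply: Rmin_pos | apply: Rmin_l].
have := exp_le _ _ (Rmin_r c (ln (1 + / (2 * P)))).
rewrite exp_ln; last lra.
move=> h; have e : P * / (2 * P) = 1/2 by field; lra.
nra.
Qed.

(* Conjugating by a slowly varying multiplier perturbs the operator by [th * A], which [K] absorbs. *)
Lemma wbound_mulseq {d} (A : Z -> mat d) c K B th (m : Z -> R) eta D :
  0 <= c -> 0 < K -> 0 < B ->
  (forall k w, vnorm (mv (A k) w) <= B * vnorm w) ->
  invertible_on A c K ->
  (forall k, 0 <= m k) ->
  (forall k, Rabs (m k - m (k - 1)%Z) <= th * m (k - 1)%Z) ->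
  0 <= th -> K * B * exp c * th <= 1 / 2 ->
  (exists D', wbound c (mulseq m eta) D') ->
  wbound c (mulseq m (gam A eta)) D ->
  wbound c (mulseq m eta) (2 * (K * D)).
Proof.
move=> c0 K0 B0 hB [_ inv] m0 hm th0 small bd hD.
apply: sup_absorb => // b hb.
(* The extra term is the commutator of [gam A] with multiplication by [m]; [exp c] pays for moving
   the weight from [k - 1] to [k]. After multiplication by [K] it is at most [b/2]. *)
suff h : wbound c (gam A (mulseq m eta)) (D + B * exp c * th * b).
  have b0 : 0 <= b.
    by apply: Rle_trans (hb 0%Z); apply: Rmult_le_pos; [apply: Rlt_le; apply: exp_pos | apply: vnorm_ge0].
  by move=> k; apply: Rle_trans (inv _ _ bd h k) _; nra.
move=> k.
have -> : gam A (mulseq m eta) k = vadd (mulseq m (gam A eta) k)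
    (vscal (m k - m (k - 1)%Z) (mv (A k) (eta (k - 1)%Z))).
  by rewrite /gam /mulseq mv_scal; vring.
have e0 := exp_pos (- (c * IZR (Z.abs k))).
apply: Rle_trans (Rmult_le_compat_l _ _ _ (Rlt_le _ _ e0) (vnorm_triangle _ _)) _.
rewrite Rmult_plus_distr_l; apply: Rplus_le_compat; first exact: hD.
rewrite vnorm_scal.
have n0 := vnorm_ge0 (eta (k - 1)%Z).
have step : exp (- (c * IZR (Z.abs k))) <= exp c * exp (- (c * IZR (Z.abs (k - 1)))).
  rewrite -exp_plus; apply: exp_le.
  have : IZR (Z.abs (k - 1)) <= IZR (Z.abs k) + 1 by rewrite -plus_IZR; apply: IZR_le; lia.
  by nra.
have hbk := hb (k - 1)%Z; rewrite /mulseq vnorm_scal (Rabs_pos_eq (m _)) // in hbk.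
have := hB k (eta (k - 1)%Z) => hBk.
have mk := m0 (k - 1)%Z.
have ec := exp_pos c.
apply: Rle_trans (_ : exp (- (c * IZR (Z.abs k))) * ((th * m (k - 1)%Z) * (B * vnorm (eta (k - 1)%Z))) <= _).
  apply: Rmult_le_compat_l; first lra.
  by apply: Rmult_le_compat => //; [apply: Rabs_pos | apply: vnorm_ge0].
apply: Rle_trans (_ : (exp c * exp (- (c * IZR (Z.abs (k - 1))))) * ((th * m (k - 1)%Z) * (B * vnorm (eta (k - 1)%Z))) <= _).
  by apply: Rmult_le_compat_r => //; repeat apply: Rmult_le_pos => //; lra.
have -> : (exp c * exp (- (c * IZR (Z.abs (k - 1))))) * ((th * m (k - 1)%Z) * (B * vnorm (eta (k - 1)%Z)))
  = B * exp c * th * (exp (- (c * IZR (Z.abs (k - 1)))) * (m (k - 1)%Z * vnorm (eta (k - 1)%Z))) by ring.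
by apply: Rmult_le_compat_l => //; repeat apply: Rmult_le_pos => //; lra.
Qed.

(* A bounded inverse survives a small change of the weight. For [c > 0] the solutions of bounded
   equations already grow at the smaller rate [c - eps]; for [c = 0] the a priori estimate extends
   to the larger rate [eps]. *)
Lemma gap_invertible_weight {d} c K B : 0 <= c -> 0 < K -> 0 < B ->
  exists c1 c2 K', 0 <= c1 < c2 /\ 0 < K' /\ forall A : Z -> mat d,
    (forall k w, vnorm (mv (A k) w) <= B * vnorm w) ->
    invertible_on A c K -> gap_invertible A c1 c2 K'.
Proof.
move=> c0 K0 B0.
have P0 : 0 < K * B * exp c by repeat apply: Rmult_lt_0_compat => //; apply: exp_pos.
case: c0 => [c0|c0].
- have [eps [[e0 ec] small]] := exp_margin _ _ P0 c0.
  exists (c - eps), c, (2 * K); split; first lra; split; first lra.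
  move=> A hB inv; split; last first.
    move=> eta D bd hD; have := proj2 inv eta D bd hD 0%Z.
    have := hD 0%Z; rewrite /= Rmult_0_r Ropp_0 exp_0 !Rmult_1_l.
    by have := vnorm_ge0 (gam A eta 0%Z); nra.
  move=> xi D hxi.
  have D0 : 0 <= D by apply: Rle_trans (hxi 0%Z); apply: vnorm_ge0.
  have wle1 k : exp (- (c * IZR (Z.abs k))) <= 1.
    rewrite -exp_0; apply: exp_le.
    have : 0 <= IZR (Z.abs k) by apply: IZR_le; lia.
    by nra.
  have xb : wbound c xi D.
    by move=> k; have := wle1 k; have := hxi k; have := vnorm_ge0 (xi k);
       have := exp_pos (- (c * IZR (Z.abs k))); nra.
  have [v [[Dv vb] hv]] := proj1 inv xi (ex_intro _ D xb).
  exists v; split=> // k0.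
  set M := IZR (Z.abs k0).
  (* Growth at rate [eps], frozen beyond [|k0|] so that the norm of [m v] is finite beforehand. The
     resulting constant does not depend on [k0], and evaluation at [k0] gives the bound. *)
  pose m k := exp (eps * Rmin (IZR (Z.abs k)) M).
  have mpos k : 0 < m k by apply: exp_pos.
  suff h : wbound c (mulseq m v) (2 * (K * D)).
    move: (h k0); rewrite /mulseq vnorm_scal Rabs_pos_eq; last exact: Rlt_le.
    rewrite /m Rmin_left; last exact: Rle_refl.
    rewrite -Rmult_assoc -exp_plus -/M => h'.
    have -> : vnorm (v k0) = exp ((c - eps) * M) * (exp (- (c * M) + eps * M) * vnorm (v k0)).
      rewrite -Rmult_assoc -exp_plus.
      have -> : (c - eps) * M + (- (c * M) + eps * M) = 0 by ring.
      by rewrite exp_0; ring.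
    have := exp_pos ((c - eps) * M); nra.
  apply: (wbound_mulseq A c K B (exp eps - 1)) => //.
  + exact: Rlt_le.
  + by move=> k; apply: Rlt_le.
  + move=> k; apply: exp_diff_le.
    have : IZR (Z.abs (k - 1)) <= IZR (Z.abs k) + 1 by rewrite -plus_IZR; apply: IZR_le; lia.
    have : IZR (Z.abs k) <= IZR (Z.abs (k - 1)) + 1 by rewrite -plus_IZR; apply: IZR_le; lia.
    rewrite -Rmult_minus_distr_l Rabs_mult (Rabs_pos_eq eps); last lra.
    move=> h1 h2; rewrite -[X in _ <= X]Rmult_1_r; apply: Rmult_le_compat_l; first lra.
    by rewrite /Rmin; do 2 case: Rle_dec => ?; split_Rabs; lra.
  + by have := exp_ineq1_le eps; lra.
  + exists (exp (eps * M) * Dv) => k; rewrite /mulseq vnorm_scal Rabs_pos_eq; last exact: Rlt_le.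
    have : m k <= exp (eps * M).
      by apply: exp_le; apply: Rmult_le_compat_l; [lra | apply: Rmin_r].
    have := vb k; have := exp_pos (- (c * IZR (Z.abs k))); have := vnorm_ge0 (v k); have := mpos k.
    set e := exp (- _); set n := vnorm _; set E := exp _ => a1 a2 a3 a4 a5.
    have : m k * (e * n) <= E * (e * n) by apply: Rmult_le_compat_r => //; nra.
    have : E * (e * n) <= E * Dv by apply: Rmult_le_compat_l => //; lra.
    by lra.
  (* Since [eps <= c], weight times multiplier is at most 1, so the bound [D] on [xi] is kept. *)
  + move=> k; rewrite /mulseq vnorm_scal Rabs_pos_eq; last exact: Rlt_le.
    rewrite hv -Rmult_assoc -exp_plus.
    have : exp (- (c * IZR (Z.abs k)) + eps * Rmin (IZR (Z.abs k)) M) <= 1.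
      rewrite -exp_0; apply: exp_le.
      have : 0 <= IZR (Z.abs k) by apply: IZR_le; lia.
      have := Rmin_l (IZR (Z.abs k)) M; nra.
    have := hxi k; have := vnorm_ge0 (xi k); set E := exp _; have : 0 < E by apply: exp_pos.
    by nra.
- subst c; have [eps [[e0 ec] small]] := exp_margin _ _ P0 Rlt_0_1.
  exists 0, eps, (2 * K); split; first lra; split; first lra.
  move=> A hB inv; split.
    move=> xi D hxi.
    have xb : wbound 0 xi D by move=> k; rewrite Rmult_0_l Ropp_0 exp_0 Rmult_1_l.
    have [v [bv hv]] := proj1 inv xi (ex_intro _ D xb).
    exists v; split=> // k.
    have gb : wbound 0 (gam A v) D by move=> j; rewrite hv; apply: xb.
    have := proj2 inv v D bv gb k; rewrite !Rmult_0_l Ropp_0 exp_0.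
    by have := hxi k; have := vnorm_ge0 (xi k); nra.
  move=> eta D [D' bd] hD.
  (* Multiplication by [m] turns the norm at rate [eps] into the sup norm. *)
  pose m k := exp (- (eps * IZR (Z.abs k))).
  have mE (u : Z -> vec d) X : wbound eps u X -> wbound 0 (mulseq m u) X.
    move=> h k; rewrite Rmult_0_l Ropp_0 exp_0 Rmult_1_l /mulseq vnorm_scal Rabs_pos_eq; first exact: h.
    by apply: Rlt_le; apply: exp_pos.
  suff h : wbound 0 (mulseq m eta) (2 * (K * D)).
    move: (h 0%Z); rewrite /mulseq vnorm_scal /m /= !Rmult_0_r Ropp_0 exp_0 Rabs_R1; lra.
  apply: (wbound_mulseq A 0 K B (exp eps - 1)) => //.
  + exact: Rle_refl.
  + by move=> k; apply: Rlt_le; apply: exp_pos.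
  + move=> k; apply: exp_diff_le.
    have : IZR (Z.abs (k - 1)) <= IZR (Z.abs k) + 1 by rewrite -plus_IZR; apply: IZR_le; lia.
    have : IZR (Z.abs k) <= IZR (Z.abs (k - 1)) + 1 by rewrite -plus_IZR; apply: IZR_le; lia.
    by move=> h1 h2; split_Rabs; nra.
  + by have := exp_ineq1_le eps; lra.
  + by exists D'; apply: mE.
  + exact: mE.
Qed.

(** * Gluing solutions along nearby orbits *)

Lemma INR_upper (x : R) : exists N : nat, x <= INR N.
Proof.
have [h _] := archimed (Rabs x); have := Rabs_pos x; have := Rle_abs x => h1 h2.
exists (Z.to_nat (up (Rabs x))); rewrite INR_IZR_INZ Z2Nat.id; first lra.
by apply: le_IZR; lra.
Qed.

Lemma exp_decay_nat g tau : 0 < g -> 0 < tau -> exists N : nat, exp (- (g * INR N)) <= tau.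
Proof.
move=> g0 t0; have [N hN] := INR_upper (- ln tau / g); exists N.
rewrite -[X in _ <= X](exp_ln tau) //; apply: exp_le.
have : g * (- ln tau / g) = - ln tau by field; lra.
have : g * (- ln tau / g) <= g * INR N by apply: Rmult_le_compat_l; lra.
lra.
Qed.

(* [w j] is read off at time [0] from the solution along [zs j]; consecutive solutions nearly agree
   because their difference solves an equation whose right-hand side is small in the [c2]-norm. *)
Lemma approximate_right_inverse {d} (DF : vec d -> mat d) B c1 c2 K :
  0 < B -> 0 < K -> 0 <= c1 < c2 ->
  (forall x w, vnorm (mv (DF x) w) <= B * vnorm w) ->
  exists (N : nat) eps, 0 < eps /\ forall (ys : Z -> vec d) (zs : Z -> Z -> vec d),
    (forall j m, (Z.abs m <= Z.of_nat N)%Z -> forall w,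
       vnorm (mv (msub (DF (zs j m)) (DF (ys (j + m)%Z))) w) <= eps * vnorm w) ->
    (forall j, gap_invertible (fun k => DF (zs j (k - 1)%Z)) c1 c2 K) ->
    forall xi b, 0 <= b -> (forall k, vnorm (xi k) <= b) ->
    exists w, forall k, vnorm (w k) <= K * b /\
      vnorm (vsub (xi k) (gam (fun k => DF (ys (k - 1)%Z)) w k)) <= b / 4.
Proof.
move=> B0 K0 [c10 c12] hB.
(* The price at rate [c1] of shifting an index by up to two. *)
set E := exp (2 * c1); have E0 : 0 < E by apply: exp_pos.
have hE1 : exp c1 <= E by apply: exp_le; lra.
(* [Q] and [Q2] are the coefficients of [eps b] and [tau b] in the final residual; [eps Q] and
   [tau Q2] are each kept at most 1/8. *)
pose Q := K * E * (1 + 2 * (B * K)).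
have KE : 0 < K * E by apply: Rmult_lt_0_compat.
have BK : 0 < B * K by apply: Rmult_lt_0_compat.
have Q0 : 0 < Q by apply: Rmult_lt_0_compat; lra.
pose Q2 := 2 * (B * K) * (K * E) * B.
have Q20 : 0 < Q2 by apply: Rmult_lt_0_compat => //; apply: Rmult_lt_0_compat; lra.
have t0 : 0 < / (8 * Q2) by apply: Rinv_0_lt_compat; lra.
have [N hN] := exp_decay_nat (c2 - c1) _ ltac:(lra) t0.
set tau := exp _ in hN; have tau0 : 0 < tau by apply: exp_pos.
pose eps := / (8 * Q); have eps0 : 0 < eps by apply: Rinv_0_lt_compat; lra.
(* The window is wider by two because the comparison at [|k| <= N] reads indices [k - 1] and
   [k - 2]. *)
exists N.+2, eps; split=> // ys zs hz hinv xi b b0 hxi.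
have solv j : exists v, (forall k, gam (fun k => DF (zs j (k - 1)%Z)) v k = xi (j + k)%Z) /\
    forall k, vnorm (v k) <= K * exp (c1 * IZR (Z.abs k)) * b.
  by apply: (proj1 (hinv j) (fun k => xi (j + k)%Z) b) => k; apply: hxi.
pose V j := proj1_sig (constructive_indefinite_description _ (solv j)).
have VE j k : V j k = vadd (xi (j + k)%Z) (mv (DF (zs j (k - 1)%Z)) (V j (k - 1)%Z)).
  rewrite /V; case: constructive_indefinite_description => v [/= hv _].
  by rewrite -hv /gam; vring.
have Vb j k : vnorm (V j k) <= K * exp (c1 * IZR (Z.abs k)) * b.
  by rewrite /V; case: constructive_indefinite_description => v [_ /=].
have zabs k (p : Z) : (0 <= p)%Z -> IZR (Z.abs (k - p)) <= IZR (Z.abs k) + IZR p.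
  by move=> p0; rewrite -plus_IZR; apply: IZR_le; lia.
have abs0 k : 0 <= IZR (Z.abs k) by apply: IZR_le; lia.
exists (fun j => V j 0%Z) => j; split.
  by have := Vb j 0%Z; rewrite /= Rmult_0_r exp_0 Rmult_1_r.
(* Time [k] along the orbit of [z_(j-1)] corresponds to time [k - 1] along that of [z_j]. *)
pose eta k := vsub (V (j - 1)%Z k) (V j (k - 1)%Z).
pose D := 2 * (K * E) * (eps + B * tau) * b.
(* A crude bound, giving the finiteness that the a priori estimate asks for. *)
have etab : wbound c2 eta (2 * (K * E * b)).
  move=> k.
  have h1 : vnorm (eta k) <= 2 * (K * (exp c1 * exp (c1 * IZR (Z.abs k))) * b).
    apply: Rle_trans (vnorm_sub _ _) _.
    have := Vb (j - 1)%Z k; have := Vb j (k - 1)%Z.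
    have a1 : exp (c1 * IZR (Z.abs (k - 1))) <= exp c1 * exp (c1 * IZR (Z.abs k)).
      by rewrite -exp_plus; apply: exp_le; have := zabs k 1%Z ltac:(lia); nra.
    have a2 : exp (c1 * IZR (Z.abs k)) <= exp c1 * exp (c1 * IZR (Z.abs k)).
      by rewrite -exp_plus; apply: exp_le; lra.
    have Kb : 0 <= K * b by nra.
    by move: a1 a2; set X := exp _ * exp _; nra.
  have h2 : exp (- (c2 * IZR (Z.abs k))) * exp (c1 * IZR (Z.abs k)) <= 1.
    by rewrite -exp_plus -exp_0; apply: exp_le; have := abs0 k; nra.
  apply: Rle_trans (Rmult_le_compat_l _ _ _ (Rlt_le _ _ (exp_pos _)) h1) _.
  have -> : exp (- (c2 * IZR (Z.abs k))) * (2 * (K * (exp c1 * exp (c1 * IZR (Z.abs k))) * b)) =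
    2 * (K * b) * exp c1 * (exp (- (c2 * IZR (Z.abs k))) * exp (c1 * IZR (Z.abs k))) by ring.
  have -> : 2 * (K * E * b) = 2 * (K * b) * E * 1 by ring.
  have Kb : 0 <= K * b by nra.
  apply: Rmult_le_compat => //.
  - by apply: Rmult_le_pos; [lra | apply: Rlt_le; apply: exp_pos].
  - by apply: Rmult_le_pos; apply: Rlt_le; apply: exp_pos.
  - by apply: Rmult_le_compat_l; lra.
(* Both equations carry the datum [xi (j + k - 1)], which cancels; a difference of derivatives
   remains. *)
have gE k : gam (fun k => DF (zs (j - 1)%Z (k - 1)%Z)) eta k =
    mv (msub (DF (zs (j - 1)%Z (k - 1)%Z)) (DF (zs j (k - 2)%Z))) (V j (k - 2)%Z).
  rewrite /gam /eta (VE (j - 1)%Z k) (VE j (k - 1)%Z) mv_sub mv_msub.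
  have -> : (k - 1 - 1 = k - 2)%Z by lia.
  have -> : (j - 1 + k = j + (k - 1))%Z by lia.
  vring.
have gb : wbound c2 (gam (fun k => DF (zs (j - 1)%Z (k - 1)%Z)) eta) D.
  move=> k; rewrite gE; have hv := Vb j (k - 2)%Z; have v0 := vnorm_ge0 (V j (k - 2)%Z).
  have Kb : 0 <= K * b by nra.
  have z2 := zabs k 2%Z ltac:(lia); have a0 := abs0 k.
  (* Inside the window both derivatives are compared with the one at [ys (j + k - 2)]; outside, the
     crude bound [2 B] is beaten by the gap of the rates. *)
  case: (Z.le_gt_cases (Z.abs k) (Z.of_nat N)) => hk.
  - have h1 : vnorm (mv (msub (DF (zs (j - 1)%Z (k - 1)%Z)) (DF (zs j (k - 2)%Z))) (V j (k - 2)%Z)) <=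
        2 * eps * vnorm (V j (k - 2)%Z).
      have := hz (j - 1)%Z (k - 1)%Z ltac:(lia) (V j (k - 2)%Z).
      have := hz j (k - 2)%Z ltac:(lia) (V j (k - 2)%Z).
      rewrite !mv_msub.
      have -> : (j - 1 + (k - 1) = j + (k - 2))%Z by lia.
      set p := mv (DF (ys _)) _; set q := mv _ _; set r := mv _ _.
      have -> : vsub r q = vsub (vsub r p) (vsub q p) by vring.
      by have := vnorm_sub (vsub r p) (vsub q p); lra.
    have h2 : exp (- (c2 * IZR (Z.abs k))) * exp (c1 * IZR (Z.abs (k - 2))) <= E.
      rewrite -exp_plus; apply: exp_le.
      have : c1 * IZR (Z.abs (k - 2)) <= c1 * (IZR (Z.abs k) + 2) by apply: Rmult_le_compat_l.
      have : 0 <= (c2 - c1) * IZR (Z.abs k) by apply: Rmult_le_pos; lra.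
      by lra.
    have h3 : vnorm (mv (msub (DF (zs (j - 1)%Z (k - 1)%Z)) (DF (zs j (k - 2)%Z))) (V j (k - 2)%Z)) <=
        2 * eps * (K * exp (c1 * IZR (Z.abs (k - 2))) * b).
      by apply: Rle_trans h1 _; apply: Rmult_le_compat_l; lra.
    apply: Rle_trans (Rmult_le_compat_l _ _ _ (Rlt_le _ _ (exp_pos _)) h3) _.
    have -> : exp (- (c2 * IZR (Z.abs k))) * (2 * eps * (K * exp (c1 * IZR (Z.abs (k - 2))) * b)) =
      2 * eps * (K * b) * (exp (- (c2 * IZR (Z.abs k))) * exp (c1 * IZR (Z.abs (k - 2)))) by ring.
    have -> : D = 2 * eps * (K * b) * E + 2 * (K * b) * (E * (B * tau)) by rewrite /D; ring.
    have : 0 <= 2 * (K * b) * (E * (B * tau)).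
      by repeat apply: Rmult_le_pos => //; lra.
    have : 2 * eps * (K * b) * (exp (- (c2 * IZR (Z.abs k))) * exp (c1 * IZR (Z.abs (k - 2)))) <=
      2 * eps * (K * b) * E.
      by apply: Rmult_le_compat_l => //; apply: Rmult_le_pos; lra.
    by lra.
  - have h1 : vnorm (mv (msub (DF (zs (j - 1)%Z (k - 1)%Z)) (DF (zs j (k - 2)%Z))) (V j (k - 2)%Z)) <=
        2 * B * vnorm (V j (k - 2)%Z).
      rewrite mv_msub; apply: Rle_trans (vnorm_sub _ _) _.
      have := hB (zs (j - 1)%Z (k - 1)%Z) (V j (k - 2)%Z).
      by have := hB (zs j (k - 2)%Z) (V j (k - 2)%Z); lra.
    have h2 : exp (- (c2 * IZR (Z.abs k))) * exp (c1 * IZR (Z.abs (k - 2))) <= E * tau.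
      rewrite -!exp_plus; apply: exp_le; rewrite INR_IZR_INZ.
      have : IZR (Z.of_nat N) <= IZR (Z.abs k) by apply: IZR_le; lia.
      move=> hNk.
      have : (c2 - c1) * IZR (Z.of_nat N) <= (c2 - c1) * IZR (Z.abs k).
        by apply: Rmult_le_compat_l; lra.
      have : c1 * IZR (Z.abs (k - 2)) <= c1 * (IZR (Z.abs k) + 2) by apply: Rmult_le_compat_l.
      by lra.
    have h3 : vnorm (mv (msub (DF (zs (j - 1)%Z (k - 1)%Z)) (DF (zs j (k - 2)%Z))) (V j (k - 2)%Z)) <=
        2 * B * (K * exp (c1 * IZR (Z.abs (k - 2))) * b).
      by apply: Rle_trans h1 _; apply: Rmult_le_compat_l; lra.
    apply: Rle_trans (Rmult_le_compat_l _ _ _ (Rlt_le _ _ (exp_pos _)) h3) _.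
    have -> : exp (- (c2 * IZR (Z.abs k))) * (2 * B * (K * exp (c1 * IZR (Z.abs (k - 2))) * b)) =
      2 * B * (K * b) * (exp (- (c2 * IZR (Z.abs k))) * exp (c1 * IZR (Z.abs (k - 2)))) by ring.
    have -> : D = 2 * B * (K * b) * (E * tau) + 2 * (K * b) * (E * eps) by rewrite /D; ring.
    have : 0 <= 2 * (K * b) * (E * eps).
      by repeat apply: Rmult_le_pos => //; lra.
    have : 2 * B * (K * b) * (exp (- (c2 * IZR (Z.abs k))) * exp (c1 * IZR (Z.abs (k - 2)))) <=
      2 * B * (K * b) * (E * tau).
      by apply: Rmult_le_compat_l => //; apply: Rmult_le_pos; lra.
    by lra.
have he := proj2 (hinv (j - 1)%Z) eta D (ex_intro _ _ etab) gb.
(* The residual consists of the mismatch [eta 0] of consecutive solutions and the cost of replacing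
   the orbit of [z_j] by [ys] at time -1. *)
have -> : vsub (xi j) (gam (fun k => DF (ys (k - 1)%Z)) (fun j => V j 0%Z) j) =
    vsub (mv (DF (ys (j - 1)%Z)) (eta 0%Z))
         (mv (msub (DF (zs j (-1)%Z)) (DF (ys (j - 1)%Z))) (V j (-1)%Z)).
  rewrite /gam /eta (VE j 0%Z) mv_sub mv_msub.
  have -> : (0 - 1 = -1)%Z by [].
  have -> : (j + 0 = j)%Z by lia.
  vring.
apply: Rle_trans (vnorm_sub _ _) _.
have h1 := hB (ys (j - 1)%Z) (eta 0%Z).
have h2 := hz j (-1)%Z ltac:(lia) (V j (-1)%Z).
rewrite (_ : (j + -1 = j - 1)%Z) in h2; last lia.
have h3 := Vb j (-1)%Z; rewrite /= Rmult_1_r in h3.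
have h4 : eps * vnorm (V j (-1)%Z) <= eps * (K * E * b).
  apply: Rmult_le_compat_l; first lra; apply: Rle_trans h3 _.
  by apply: Rmult_le_compat_r => //; apply: Rmult_le_compat_l; lra.
have h5 : B * vnorm (eta 0%Z) <= B * (K * D) by apply: Rmult_le_compat_l; lra.
have e1 : eps * Q = 1 / 8 by rewrite /eps; field; lra.
have e2 : tau * Q2 <= 1 / 8.
  have -> : 1 / 8 = / (8 * Q2) * Q2 by field; lra.
  by apply: Rmult_le_compat_r; lra.
have : B * (K * D) + eps * (K * E * b) = (eps * Q + tau * Q2) * b.
  by rewrite /D /Q /Q2; ring.
have : (eps * Q + tau * Q2) * b <= (1 / 4) * b by apply: Rmult_le_compat_r; lra.
lra.
Qed.

(** * Newton iteration *)

(** Dependent choice, by recursion on states bundled with their proof of [P]. *)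
Lemma dependent_sequence {T : Type} (P : nat -> T -> Prop) (Q : nat -> T -> T -> Prop) x0 :
  P 0%nat x0 -> (forall i x, P i x -> exists y, P i.+1 y /\ Q i x y) ->
  exists u : nat -> T, u 0%nat = x0 /\ forall i, P i (u i) /\ Q i (u i) (u i.+1).
Proof.
move=> h0 hS.
pose next i (s : {x | P i x}) := constructive_indefinite_description _ (hS i _ (proj2_sig s)).
pose U := nat_rect (fun i => {x | P i x}) (exist _ x0 h0)
  (fun i s => exist _ (proj1_sig (next i s)) (proj1 (proj2_sig (next i s)))).
exists (fun i => proj1_sig (U i)); split=> // i; split; first exact: proj2_sig.
exact: proj2 (proj2_sig (next i (U i))).
Qed.

(** The intervals of radius [2 C / 2^i] around [f i] are nested; the limit is the supremum of their
    left ends. *)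
Lemma geometric_limit (f : nat -> R) C :
  (forall i, Rabs (f i.+1 - f i) <= C * (1/2)^i) ->
  exists l, forall i, Rabs (f i - l) <= 2 * C * (1/2)^i.
Proof.
move=> h.
have C0 : 0 <= C by have := h 0%nat; have := Rabs_pos (f 1%nat - f 0%nat); rewrite /=; lra.
pose e i := 2 * C * (1/2)^i.
have e0 i : 0 <= e i by apply: Rmult_le_pos; [lra | apply: pow_le; lra].
have eS i : e i.+1 = e i / 2 by rewrite /e /=; field.
have hl i : f i - e i <= f i.+1 - e i.+1.
  by have := h i; rewrite eS /e; split_Rabs; lra.
have hu i : f i.+1 + e i.+1 <= f i + e i.
  by have := h i; rewrite eS /e; split_Rabs; lra.
have hlD i j : f i - e i <= f (i + j)%coq_nat - e (i + j)%coq_nat.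
  elim: j => [|j IH]; first by rewrite Nat.add_0_r; lra.
  by rewrite Nat.add_succ_r; have := hl (i + j)%coq_nat; lra.
have huD i j : f (i + j)%coq_nat + e (i + j)%coq_nat <= f i + e i.
  elim: j => [|j IH]; first by rewrite Nat.add_0_r; lra.
  by rewrite Nat.add_succ_r; have := hu (i + j)%coq_nat; lra.
have cross i j : f i - e i <= f j + e j.
  have := hlD i j; have := huD j i; rewrite (Nat.add_comm j i).
  by have := e0 (i + j)%coq_nat; lra.
have [||l [l1 l2]] := completeness (fun x => exists i, x = f i - e i).
- by exists (f 0%nat + e 0%nat) => x [i ->].
- by exists (f 0%nat - e 0%nat), 0%nat.
exists l => i.
have : f i - e i <= l by apply: l1; exists i.
have : l <= f i + e i by apply: l2 => x [j ->].
by rewrite -/(e i); split_Rabs; lra.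
Qed.

Lemma half_pow_small C eps : 0 < eps -> exists i, C * (1/2)^i < eps.
Proof.
move=> e0; have C0 := Rabs_pos C.
have q : 0 < eps / (Rabs C + 1) by apply: Rdiv_lt_0_compat; lra.
have [i hi] := pow_lt_1_zero (1/2) ltac:(rewrite Rabs_pos_eq; lra) _ q.
exists i; have := hi i (le_n i); have p0 : 0 <= (1/2)^i by apply: pow_le; lra.
rewrite Rabs_pos_eq // => h.
have : (Rabs C + 1) * (eps / (Rabs C + 1)) = eps by field; lra.
have := Rle_abs C; nra.
Qed.

(** The approximate right inverse leaves [b/4] of the error, and the Taylor remainder with slope
    [1/(4 K)] on steps of length [K b] adds at most [b/4]. The integer vectors [p] are kept. *)
Lemma newton_step {d} (F : vec d -> vec d) (DF : vec d -> mat d) B c1 c2 K :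
  (forall x, has_deriv F x (DF x)) -> deriv_uniform DF ->
  0 < B -> 0 < K -> 0 <= c1 < c2 ->
  (forall x w, vnorm (mv (DF x) w) <= B * vnorm w) ->
  exists (N : nat) del r, 0 < del /\ 0 < r /\
  forall (ys : Z -> vec d) (zs : Z -> Z -> vec d) (p : Z -> ivec d) b,
    (forall j m, (Z.abs m <= Z.of_nat N)%Z -> tclose (zs j m) (ys (j + m)%Z) del) ->
    (forall j, gap_invertible (fun k => DF (zs j (k - 1)%Z)) c1 c2 K) ->
    0 <= b -> K * b < r ->
    (forall k, vnorm (vsub (vadd (F (ys (k - 1)%Z)) (vofZ (p k))) (ys k)) <= b) ->
    exists ys', forall k, vnorm (vsub (ys' k) (ys k)) <= K * b /\
      vnorm (vsub (vadd (F (ys' (k - 1)%Z)) (vofZ (p k))) (ys' k)) <= b / 2.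
Proof.
move=> hD unif B0 K0 c12 hB.
have [N [eps [eps0 lin]]] := approximate_right_inverse DF B c1 c2 K B0 K0 c12 hB.
have [del [del0 hdel]] := unif eps eps0.
have q0 : 0 < / (4 * K) by apply: Rinv_0_lt_compat; lra.
have [r [r0 hr]] := taylor_uniform F DF hD unif _ q0.
exists N, del, r; split=> //; split=> // ys zs p b hz hinv b0 Kb err.
have [w hw] := lin ys zs (fun j m hm => hdel _ _ (hz j m hm)) hinv
  (fun k => vsub (vadd (F (ys (k - 1)%Z)) (vofZ (p k))) (ys k)) b b0 err.
exists (fun k => vadd (ys k) (w k)) => k; have [w1 w2] := hw k; split.
  by have -> : vsub (vadd (ys k) (w k)) (ys k) = w k by vring.
have w3 := proj1 (hw (k - 1)%Z).
have t := hr (ys (k - 1)%Z) (w (k - 1)%Z) ltac:(lra).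
have t' : / (4 * K) * vnorm (w (k - 1)%Z) <= b / 4.
  have -> : b / 4 = / (4 * K) * (K * b) by field; lra.
  by apply: Rmult_le_compat_l; lra.
move: w2 t; rewrite /gam; set G := F (vadd _ _); set G0 := F (ys _) => w2 t.
have -> : vsub (vadd G (vofZ (p k))) (vadd (ys k) (w k)) =
  vadd (vsub (vsub G G0) (mv (DF (ys (k - 1)%Z)) (w (k - 1)%Z)))
   (vsub (vsub (vadd G0 (vofZ (p k))) (ys k)) (vsub (w k) (mv (DF (ys (k - 1)%Z)) (w (k - 1)%Z)))) by vring.
apply: Rle_trans (vnorm_triangle _ _) _; lra.
Qed.

Lemma newton_shadowing {d} (F : vec d -> vec d) (DF : vec d -> mat d) B c1 c2 K :
  (forall x, has_deriv F x (DF x)) -> deriv_uniform DF ->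
  0 < B -> 0 < K -> 0 <= c1 < c2 ->
  (forall x w, vnorm (mv (DF x) w) <= B * vnorm w) ->
  exists (N : nat) del r, 0 < del /\ 0 < r /\
  forall (ys : Z -> vec d) (zs : Z -> Z -> vec d) (p : Z -> ivec d) b,
    (forall j m, (Z.abs m <= Z.of_nat N)%Z -> tclose (zs j m) (ys (j + m)%Z) del) ->
    (forall j, gap_invertible (fun k => DF (zs j (k - 1)%Z)) c1 c2 K) ->
    0 <= b -> 2 * (K * b) < r ->
    (forall k, vnorm (vsub (vadd (F (ys (k - 1)%Z)) (vofZ (p k))) (ys k)) <= b) ->
    exists xs, (forall k, xs k = vadd (F (xs (k - 1)%Z)) (vofZ (p k))) /\
      forall k, vnorm (vsub (xs k) (ys k)) <= INR d * (2 * (K * b)).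
Proof.
move=> hD unif B0 K0 c12 hB.
have [N [del [r [del0 [r0 step]]]]] := newton_step F DF B c1 c2 K hD unif B0 K0 c12 hB.
(* The other half of [del] is reserved for the drift of the iterates, which stay within [2 K b] of
   [ys]; the orbits [zs] therefore serve every step. *)
exists N, (del/2), (Rmin (del/2) r); split; first lra; split; first by apply: Rmin_pos; lra.
move=> ys zs p b hz hinv b0 small err.
have sm1 := Rlt_le_trans _ _ _ small (Rmin_l _ _).
have sm2 := Rlt_le_trans _ _ _ small (Rmin_r _ _).
have Kb0 : 0 <= K * b by nra.
have half0 i : 0 <= (1/2)^i by apply: pow_le; lra.
have half1 i : (1/2)^i <= 1 by elim: i => [|i IH] /=; [lra | have := half0 i; lra].
(* The displacement is the partial geometric sum of the steps [K b / 2^i]. *)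
pose P i (y : Z -> vec d) :=
  (forall k, vnorm (vsub (y k) (ys k)) <= 2 * (K * b) * (1 - (1/2)^i)) /\
  forall k, vnorm (vsub (vadd (F (y (k - 1)%Z)) (vofZ (p k))) (y k)) <= b * (1/2)^i.
pose Q i (y y' : Z -> vec d) := forall k, vnorm (vsub (y' k) (y k)) <= K * b * (1/2)^i.
have P0 : P 0%nat ys.
  split=> k /=; last by rewrite Rmult_1_r.
  have -> : vsub (ys k) (ys k) = vzero by vring.
  by rewrite vnorm_zero; lra.
have PS i y : P i y -> exists y', P i.+1 y' /\ Q i y y'.
  move=> [yclose yerr]; have h0 := half0 i; have h1 := half1 i.
  have bi : 0 <= b * (1/2)^i by nra.
  have bib : K * (b * (1/2)^i) <= K * b by nra.
  case: (step y zs p (b * (1/2)^i)) => //.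
  - move=> j m hm; have -> : del = del/2 + del/2 by lra.
    apply: tclose_trans (hz j m hm) _; apply: tclose_vnorm; rewrite vnorm_subC.
    by have := yclose (j + m)%Z; nra.
  - lra.
  move=> y' hy'; exists y'; split; last by move=> k; have := proj1 (hy' k); lra.
  split=> k; have [y1 y2] := hy' k; last by rewrite /=; lra.
  have -> : vsub (y' k) (ys k) = vadd (vsub (y' k) (y k)) (vsub (y k) (ys k)) by vring.
  by apply: Rle_trans (vnorm_triangle _ _) _; have := yclose k; rewrite /=; lra.
have [u [u0 hu]] := dependent_sequence P Q ys P0 PS.
(* Limits are taken coordinate by coordinate, whence the factor [INR d] in the conclusion. *)
have lim k (c : 'I_d) : exists l, forall i, Rabs (u i k c - l) <= 2 * (K * b) * (1/2)^i.
  apply: geometric_limit => i; apply: Rle_trans (proj2 (hu i) k).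
  exact: (vnorm_comp (vsub (u i.+1 k) (u i k)) c).
pose xs k : vec d := fun c => proj1_sig (constructive_indefinite_description _ (lim k c)).
have xsP k i : vnorm (vsub (u i k) (xs k)) <= INR d * (2 * (K * b)) * (1/2)^i.
  rewrite Rmult_assoc; apply: vnorm_le_sup; first by have := half0 i; nra.
  by move=> c; rewrite /vsub /xs; case: constructive_indefinite_description => l /=.
exists xs; split; last first.
  by move=> k; rewrite vnorm_subC -u0; have := xsP k 0%nat; rewrite /=; lra.
move=> k.
suff : vsub (vadd (F (xs (k - 1)%Z)) (vofZ (p k))) (xs k) = vzero.
  move=> h; apply: vec_eq => c; have := f_equal (fun v => v c) h.
  by rewrite /vsub /vzero; lra.
apply: vnorm0_eq; apply: le_epsilon => e e0; rewrite Rplus_0_l.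
have [a [a0 ha]] := has_deriv_continuous F _ _ (hD (xs (k - 1)%Z)) (e/2) ltac:(lra).
set C := INR d * (2 * (K * b)) in xsP.
have C0 : 0 <= C by have := pos_INR d; rewrite /C; nra.
have m0 : 0 < Rmin a (e/2) by apply: Rmin_pos; lra.
(* One index makes both the distance to the limit and the remaining error small; continuity of [F]
   at the limit then closes the equation up to [e]. *)
have [i hi] := half_pow_small (C + b) _ m0.
have hi1 := Rlt_le_trans _ _ _ hi (Rmin_l _ _); have hi2 := Rlt_le_trans _ _ _ hi (Rmin_r _ _).
have bi : 0 <= b * (1/2)^i by have := half0 i; nra.
have f1 := ha (u i (k - 1)%Z) ltac:(have := xsP (k - 1)%Z i; lra).
have f2 := proj2 (proj1 (hu i)) k; have f3 := xsP k i.
have -> : vsub (vadd (F (xs (k - 1)%Z)) (vofZ (p k))) (xs k) =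
  vadd (vsub (F (xs (k - 1)%Z)) (F (u i (k - 1)%Z)))
   (vadd (vsub (vadd (F (u i (k - 1)%Z)) (vofZ (p k))) (u i k)) (vsub (u i k) (xs k))) by vring.
apply: Rle_trans (vnorm_triangle _ _) _; rewrite vnorm_subC.
have := vnorm_triangle (vsub (vadd (F (u i (k - 1)%Z)) (vofZ (p k))) (u i k)) (vsub (u i k) (xs k)).
lra.
Qed.

(** * From a continuous inverse to a norm bound *)

Definition rate (n : nbar) : R := match n with NFin m => / INR m | NInf => 0 end.

Lemma weightE n k : weight n k = exp (- (rate n * IZR (Z.abs k))).
Proof.
case: n => [m|] /=; last by rewrite Rmult_0_l Ropp_0 exp_0.
by congr exp; rewrite /Rdiv; ring.
Qed.

Lemma rate_ge0 n : nbar_ok n -> 0 <= rate n.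
Proof.
case: n => [m|] /= h; last lra.
apply: Rlt_le; apply: Rinv_0_lt_compat; apply: lt_0_INR.
by move/leP: h; lia.
Qed.

(** Continuity of the inverse at zero, rescaled by linearity of [Gamma], bounds it by [2 / del]. An
    integer bound is taken so that natural numbers can index the filtration. *)
Lemma cont_inverse_invertible_on {d} (DF : vec d -> mat d) n (xs : Z -> vec d) :
  has_cont_inverse n (Gamma DF xs) ->
  exists K : nat, invertible_on (fun k => DF (xs (k - 1)%Z)) (rate n) (INR K + 1).
Proof.
move=> [_ [S [SX [TS [ST cont]]]]].
have XE (eta : Z -> vec d) : inX n eta <-> exists D, wbound (rate n) eta D.
  by split=> -[D h]; exists D => k; move: (h k); rewrite weightE; apply.
pose zero : Z -> vec d := fun=> vzero.
have T0 : Gamma DF xs zero = zero.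
  by apply: functional_extensionality => k; rewrite /Gamma /zero mv_zero; vring.
have X0 : inX n zero by exists 0 => k; rewrite /zero vnorm_zero; lra.
have S0 : S zero = zero by rewrite -{1}T0; apply: ST.
have [del [del0 hdel]] := cont zero X0 1 Rlt_0_1.
have [K hK] := INR_upper (2 / del).
exists K; split.
  move=> xi /XE hxi; exists (S xi); split; first by apply/XE; apply: SX.
  by move=> k; rewrite -{2}(TS xi hxi).
move=> eta D /XE hX hD k.
have D0 : 0 <= D.
  apply: Rle_trans (hD k); apply: Rmult_le_pos; last exact: vnorm_ge0.
  by apply: Rlt_le; apply: exp_pos.
apply: (Rle_trans _ (2 / del * D)); last by apply: Rmult_le_compat_r; lra.
apply: le_epsilon => e e0.
have de0 : 0 < del * e by apply: Rmult_lt_0_compat.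
have De : 0 < D + del * e / 2 by lra.
(* Scales the image to norm below [del]; the term with [e] keeps the denominator positive when
   [D = 0], and [1 / t = 2 D / del + e]. *)
pose t := del / (2 * (D + del * e / 2)).
have t0 : 0 < t by apply: Rdiv_lt_0_compat; lra.
have tE : t * (D + del * e / 2) = del / 2 by rewrite /t; field; lra.
pose teta : Z -> vec d := fun k => vscal t (eta k).
pose txi : Z -> vec d := fun k => vscal t (Gamma DF xs eta k).
have TE : Gamma DF xs teta = txi.
  by apply: functional_extensionality => j; rewrite /teta /txi /Gamma mv_scal; vring.
have wscal (v : Z -> vec d) b : wbound (rate n) v b -> wbound (rate n) (fun k => vscal t (v k)) (t * b).
  move=> h j; rewrite vnorm_scal Rabs_pos_eq; last lra.
  by have := Rmult_le_compat_l t _ _ (Rlt_le _ _ t0) (h j); lra.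
have Xt : inX n teta.
  by apply/XE; have [b hb] := proj1 (XE eta) hX; exists (t * b); apply: wscal.
have Xt' : inX n txi by apply/XE; exists (t * D); apply: wscal.
have sub0 (v : Z -> vec d) j : vnorm (seqsub zero v j) = vnorm (v j).
  by rewrite /seqsub /zero vnorm_subC; congr vnorm; vring.
case: (hdel txi Xt').
  exists (t * D); split; first by nra.
  by move=> j; rewrite sub0 weightE; apply: wscal.
move=> s [s1 /(_ k)]; rewrite S0 -TE ST // sub0 weightE /teta vnorm_scal Rabs_pos_eq; last lra.
set w := exp _; set v := vnorm _ => h.
have : t * (w * v) <= 1 by lra.
have -> : 2 / del * D + e = 1 / t by rewrite /t; field; lra.
move=> h2; apply: (Rmult_le_reg_l t) => //.
by have -> : t * (1 / t) = 1 by field; lra.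
Qed.

(** * Filtration by the norm of the inverse and the shadowing orbit *)

Theorem theorem3 (d : nat) (F : vec d -> vec d) (DF : vec d -> mat d) (alpha : R)
  (L : vec d -> Prop) :
  0 < alpha ->
  C1alpha_diffeo F DF alpha ->
  torus_set L ->
  f_invariant F L ->
  (exists n : nbar, nbar_ok n /\
     forall x, L x -> forall xs, is_orbit F xs -> teq (xs 0%Z) x ->
       has_cont_inverse n (Gamma DF xs)) ->
  shadowable F L.
Proof.
move=> al0 [hD [[C hol] [desF [G [[DG [hDG _]] [desG [GF FG]]]]]]] torL _ [n [nok inv]].
have per := deriv_periodic F DF hD desF.
have unif := holder_deriv_uniform DF C alpha al0 per hol.
have [B [B0 hB]] := deriv_bounded DF per unif.
have uF := has_deriv_tuniform F DF hD desF.
have uG := has_deriv_tuniform G DG hDG desG.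
pose A (xs : Z -> vec d) k := DF (xs (k - 1)%Z).
(* Asking for some representing sequence of the orbit makes [Ls K] invariant under integer
   translations. *)
pose Ls (K : nat) x := L x /\ exists xs, is_orbit F xs /\ teq (xs 0%Z) x /\
  invertible_on (A xs) (rate n) (INR K + 1).
exists Ls; split; [|split; [|split]].
- move=> K x k; split=> -[Lx [xs [oxs [txs ixs]]]]; split.
  + exact: (proj1 (torL x k) Lx).
  + by exists xs; split=> //; split=> //; apply: teq_trans txs _; exists k.
  + exact: (proj2 (torL x k) Lx).
  + exists xs; split=> //; split=> //; apply: teq_trans txs _.
    by apply: teq_sym; exists k.
- move=> K x [Lx [xs [oxs [txs [surj est]]]]]; split=> //; exists xs; split=> //; split=> //.
  split=> // eta D hX hD' k; apply: Rle_trans (est eta D hX hD' k) _.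
  rewrite S_INR; suff : 0 <= D by lra.
  apply: Rle_trans (hD' k); apply: Rmult_le_pos; last exact: vnorm_ge0.
  by apply: Rlt_le; apply: exp_pos.
- move=> x; split; last by move=> [K []].
  move=> Lx; have [xs [oxs txs]] := orbit_exists F G x FG.
  have [K hK] := cont_inverse_invertible_on DF n xs (inv x Lx xs oxs txs).
  by exists K; split=> //; exists xs.
have main (K : nat) : exists delta, 0 < delta /\ exists rho0, 0 < rho0 /\
    forall rho, 0 < rho < rho0 -> exists beta, 0 < beta /\
      forall ys : Z -> vec d, pseudo_orbit F beta ys ->
        (forall j, exists z, Ls K z /\ tclose (ys j) z delta) ->
        exists xs, is_orbit F xs /\ forall j, tclose (xs j) (ys j) rho.
  have K0 : 0 < INR K + 1 by have := pos_INR K; lra.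
  have [c1 [c2 [K' [c12 [K'0 gap]]]]] :=
    gap_invertible_weight (d := d) (rate n) _ B (rate_ge0 n nok) K0 B0.
  have [N [del [r [del0 [r0 newton]]]]] := newton_shadowing F DF B c1 c2 K' hD unif B0 K'0 c12 hB.
  have [delta [delta0 track]] := pseudo_orbit_track F G uF uG desG GF N del del0.
  (* [delta] comes from tracking and is fixed before [rho]; the value 1 is arbitrary, since
     [Rmin r rho] below handles every positive [rho]. *)
  exists delta; split=> //; exists 1; split; first lra.
  move=> rho [rho_pos _]; have d0 := pos_INR d.
  (* With this [M], the numbers [2 K' b] and [d (2 K' b)] sum to [Rmin r rho / 2]: the first stays
     below the Newton radius [r], the second below [rho]. *)
  pose M := (INR d + 1) * (2 * K').
  have M0 : 0 < M by apply: Rmult_lt_0_compat; lra.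
  pose b := Rmin r rho / (2 * M).
  have mr : 0 < Rmin r rho by exact: Rmin_pos.
  have b0 : 0 < b by apply: Rdiv_lt_0_compat; lra.
  have bM : M * b = Rmin r rho / 2 by rewrite /b; field; lra.
  have bM' : INR d * (2 * (K' * b)) + 2 * (K' * b) = Rmin r rho / 2 by rewrite -bM /M; ring.
  have Kb0 : 0 < K' * b by apply: Rmult_lt_0_compat.
  have dKb : 0 <= INR d * (2 * (K' * b)) by apply: Rmult_le_pos; lra.
  have := Rmin_l r rho; have := Rmin_r r rho => m1 m2.
  exists (Rmin delta b); split; first exact: Rmin_pos.
  move=> ys pys hys.
  have zex j : exists zs, is_orbit F zs /\ tclose (ys j) (zs 0%Z) delta /\
      invertible_on (A zs) (rate n) (INR K + 1).
    have [z [[_ [zs [ozs [tzs izs]]]] cz]] := hys j.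
    exists zs; split=> //; split=> //.
    exact: teq_tclose (teq_refl _) (teq_sym _ _ tzs) cz.
  pose zs j := proj1_sig (constructive_indefinite_description _ (zex j)).
  have zsP j : is_orbit F (zs j) /\ tclose (ys j) (zs j 0%Z) delta /\
      invertible_on (A (zs j)) (rate n) (INR K + 1).
    by rewrite /zs; case: constructive_indefinite_description.
  (* The integer vectors realizing the jumps turn the torus pseudo-orbit into a Euclidean one. *)
  pose p k := proj1_sig (constructive_indefinite_description _ (pys k)).
  have pP k : vnorm (vadd (vsub (F (ys (k - 1)%Z)) (ys k)) (vofZ (p k))) < Rmin delta b.
    by rewrite /p; case: constructive_indefinite_description.
  case: (newton ys zs p b).
  - move=> j m hm; apply: tclose_sym.
    have [oz [cz _]] := zsP j; apply: track => // k.
    exact: tclose_le (Rmin_l _ _) (pys k).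
  - move=> j; apply: gap; last by have [_ []] := zsP j.
    by move=> k w; apply: hB.
  - lra.
  - lra.
  - move=> k.
    have -> : vsub (vadd (F (ys (k - 1)%Z)) (vofZ (p k))) (ys k) =
      vadd (vsub (F (ys (k - 1)%Z)) (ys k)) (vofZ (p k)) by vring.
    by have := pP k; have := Rmin_r delta b; lra.
  move=> xs [oxs cxs]; exists xs; split; first by move=> k; exists (p k).
  by move=> j; apply: tclose_vnorm; have := cxs j; lra.
exists (fun K => proj1_sig (constructive_indefinite_description _ (main K))).
by split=> K; case: constructive_indefinite_description => delta [].
Qed.
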